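(* Let $\Omega\subset\mathbb{R}^d$ be open, bounded and convex, let $f\in L^2(\Omega)$, $\lambda>0$, and let $L$, $V_\ell$, $\mathcal{E}_{reg}$ and $\mathcal{E}_{reg,\ell}$ be as described in the context. Assume that the convex functional $\mathcal{J}$ is $H^2(\Omega)$ consistent. Let $(u_\ell)$, $u_\ell\in V_\ell$, be a sequence of minimisers of $\mathcal{E}_{reg,\ell}$. Then $$u_\ell\to u^{(\lambda)}\quad\text{in }H^1(\Omega)\quad\text{as }\ell\to\infty,$$ where $u^{(\lambda)}$ is the exact solution of the regularised problem, i.e. the minimiser of $\mathcal{E}_{reg}$ over $H^2(\Omega)\cap H^1_0(\Omega)$.
   Context: $Lu:=-\sum_{1\le i,j\le d}(a_{ij}u_{x_i})_{x_j}+cu$ is a self-adjoint elliptic operator: $a_{ij}=a_{ji}$ and $c$ are smooth on $\overline\Omega$, $c>0$, and there is $\theta_0>0$ with $\sum_{i,j}a_{ij}(x)\xi_i\xi_j\ge\theta_0|\xi|^2$ for all $x\in\Omega$, $\xi\in\mathbb{R}^d$. $\mathcal{E}(v)=\int_\Omega|Lv-f|^2\,dx$ and $\mathcal{E}_{reg}(v)=\mathcal{E}(v)+\lambda\mathcal{J}(v)$. $(V_\ell)_{\ell\in\mathbb{N}}$ is a sequence of (not necessarily linear) sets of functions $V_\ell\subset H^2(\Omega)\cap H^1_0(\Omega)$ (for instance, neural network spaces satisfying the zero boundary condition exactly) such that for each $w\in H^1_0(\Omega)\cap H^2(\Omega)$ there exist $w_\ell\in V_\ell$ with $\|w_\ell-w\|_{H^2(\Omega)}\le\beta_\ell(w)$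 and $\beta_\ell(w)\to0$ as $\ell\to\infty$; if in addition $w\in H^m(\Omega)$ for a fixed $m>2$, then $\|w_\ell-w\|_{H^2(\Omega)}\le\tilde\beta_\ell\|w\|_{H^m(\Omega)}$ with $\tilde\beta_\ell\to0$ independent of $w$. $\mathcal{E}_{reg,\ell}(v)=\mathcal{E}_{reg}(v)$ if $v\in V_\ell\cap H^2(\Omega)\cap H^1_0(\Omega)$ and $\mathcal{E}_{reg,\ell}(v)=+\infty$ otherwise. For a Sobolev (sub)space $\mathcal{H}$, a functional $\mathcal{J}$ on $\mathcal{H}$ is called $\mathcal{H}$ consistent if: (i) $\mathcal{J}(v)\ge0$; (ii) $\mathcal{J}(v)\le\liminf_{\ell\to\infty}\mathcal{J}(v_\ell)$ for all weakly convergent sequences $v_\ell\rightharpoonup v$ in $\mathcal{H}$; (iii) $\mathcal{J}(w)=\lim_{\ell\to\infty}\mathcal{J}(w_\ell)$ for all convergent sequences $w_\ell\to w$ in $\mathcal{H}$. *)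

(* Defs.v *)
From HB Require Import structures.
From mathcomp Require Import all_boot all_order all_algebra.
From mathcomp Require Import all_classical all_reals all_analysis.

Set Implicit Arguments.
Unset Strict Implicit.
Unset Printing Implicit Defensive.

Import Order.TTheory GRing.Theory Num.Theory.
Import numFieldNormedType.Exports.

Local Open Scope classical_set_scope.
Local Open Scope ring_scope.

(* The measurable sets of 'rV[R]_d are generated by the coordinate maps, i.e.
   they are the Borel sets of R^d, as for n.-tuple in the library. *)
Section measurable_rV.
Context {R : realType} (d : nat).

Let coors : 'I_d -> 'rV[R]_d -> R := fun i x => x ord0 i.

Let rV_set0 : g_sigma_preimage coors set0.
Proof. exact: sigma_algebra0. Qed.

Let rV_setC A : g_sigma_preimage coors A -> g_sigma_preimage coors (~` A).
Proof. exact: sigma_algebraC. Qed.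

Let rV_bigcup (F : (set 'rV[R]_d)^nat) :
  (forall i, g_sigma_preimage coors (F i)) ->
  g_sigma_preimage coors (\bigcup_i (F i)).
Proof. exact: sigma_algebra_bigcup. Qed.

HB.instance Definition _ := @isMeasurable.Build default_measure_display
  'rV[R]_d (g_sigma_preimage coors) rV_set0 rV_setC rV_bigcup.

End measurable_rV.

Section lebesgue_rV.
Context {R : realType}.

Lemma measurable_coord (d : nat) (i : 'I_d) :
  measurable_fun [set: 'rV[R]_d] (fun x : 'rV[R]_d => x ord0 i).
Proof.
move=> _ Y mY; rewrite setTI; apply: sub_sigma_algebra => /=.
rewrite -bigcup_seq/=; exists i => /=; first by rewrite mem_index_enum.
by exists Y => //; rewrite setTI.
Qed.

Lemma measurable_fun_rV d' (T : measurableType d') (d : nat)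
    (f : T -> 'rV[R]_d) :
  (forall i, measurable_fun [set: T] (fun x => f x ord0 i)) ->
  measurable_fun [set: T] f.
Proof.
move=> mf _ A mA; rewrite setTI; move: A mA.
pose C := [set A : set 'rV[R]_d | measurable (f @^-1` A)].
rewrite -[forall A, _]/(measurable `<=` C).
apply: smallest_sub.
- split => /=; rewrite /C/=.
  + by rewrite preimage_set0.
  + by move=> A mA; rewrite setTD preimage_setC; exact: measurableC.
  + by move=> F mF; rewrite preimage_bigcup; exact: bigcup_measurable.
- move=> A /=; rewrite -bigcup_seq => -[i _ [B mB <-]].
  by rewrite setTI /C/= -comp_preimage; have := mf i measurableT B mB; rewrite setTI.
Qed.

Definition rV_cons (d : nat) (p : R * 'rV[R]_d) : 'rV[R]_d.+1 :=
  \row_i (if unlift ord0 i is Some j then p.2 ord0 j else p.1).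

Definition rV_uncons (d : nat) (x : 'rV[R]_d.+1) : R * 'rV[R]_d :=
  (x ord0 ord0, \row_j x ord0 (lift ord0 j)).

Lemma rV_consK (d : nat) : cancel (@rV_cons d) (@rV_uncons d).
Proof.
move=> [t y]; rewrite /rV_uncons /rV_cons mxE unlift_none/=; congr pair.
by apply/rowP => j; rewrite !mxE liftK.
Qed.

Lemma measurable_rV_cons (d : nat) : measurable_fun setT (@rV_cons d).
Proof.
apply: measurable_fun_rV => i; rewrite /rV_cons.
case: (unliftP ord0 i) => [j ->|->].
- rewrite (_ : (fun _ => _) = (fun y : 'rV[R]_d => y ord0 j) \o snd).
    by apply: measurableT_comp => //; exact: measurable_coord.
  by apply/funext => p/=; rewrite mxE liftK.
- rewrite (_ : (fun _ => _) = fst) //.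
  by apply/funext => p/=; rewrite mxE unlift_none.
Qed.

Lemma measurable_rV_uncons (d : nat) : measurable_fun setT (@rV_uncons d).
Proof.
apply: measurable_fun_pair => /=; first exact: measurable_coord.
apply: measurable_fun_rV => i.
rewrite (_ : (fun _ => _) = fun x : 'rV[R]_d.+1 => x ord0 (lift ord0 i)).
  exact: measurable_coord.
by apply/funext => x; rewrite mxE.
Qed.

Section rV_cons_measure.
Local Open Scope ereal_scope.
Context (d : nat) (mu : {sigma_finite_measure set 'rV[R]_d -> \bar R}).

(* The image of the product measure dt (x) mu on R * R^d under the
   identification of R * R^d with R^(d+1). *)
Definition rV_cons_measure : set 'rV[R]_d.+1 -> \bar R :=
  pushforward (lebesgue_measure \x mu) (@rV_cons d).

Let mcons : measurable_fun [set: measurableTypeR R * 'rV[R]_d] (@rV_cons d) :=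
  @measurable_rV_cons d.

Let m := measure_function_pushforward__canonical__measure_function_Measure
  (lebesgue_measure \x mu) mcons.

Let rV_cons_measure0 : rV_cons_measure set0 = 0.
Proof. exact: (measure0 m). Qed.

Let rV_cons_measure_ge0 A : 0 <= rV_cons_measure A.
Proof. exact: (measure_ge0 m). Qed.

Let rV_cons_measure_sigma_additive : semi_sigma_additive rV_cons_measure.
Proof. exact: (@measure_semi_sigma_additive _ _ _ m). Qed.

HB.instance Definition _ := isMeasure.Build _ _ _ rV_cons_measure
  rV_cons_measure0 rV_cons_measure_ge0 rV_cons_measure_sigma_additive.

Let rV_cons_measure_sigma_finite : sigma_finite setT rV_cons_measure.
Proof.
have /sigma_finiteP[F [FT ndF Foo]] := sigma_finiteT (@lebesgue_measure R).
have /sigma_finiteP[G [GT ndG Goo]] := sigma_finiteT mu.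
exists (fun n => @rV_uncons d @^-1` (F n `*` G n)).
  apply/esym; rewrite -subTset => x _.
  have [n _ Fn] : (\bigcup_n F n) (rV_uncons x).1 by rewrite -FT.
  have [k _ Gk] : (\bigcup_n G n) (rV_uncons x).2 by rewrite -GT.
  exists (maxn n k) => //; split.
  - by apply: (subsetPset _ _ (ndF _ _ (leq_maxl n k))).
  - by apply: (subsetPset _ _ (ndG _ _ (leq_maxr n k))).
move=> n; have [mFn Fnoo] := Foo n; have [mGn Gnoo] := Goo n.
have mFG : measurable (F n `*` G n) by exact: measurableX.
split.
  by have := @measurable_rV_uncons d measurableT _ mFG; rewrite setTI.
rewrite /rV_cons_measure /pushforward -comp_preimage.
rewrite (_ : _ \o _ = id) ?preimage_id; last first.
  by apply/funext => p /=; exact: rV_consK.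
by rewrite product_measure1E// lte_mul_pinfty// ge0_fin_numE.
Qed.

HB.instance Definition _ := Measure_isSigmaFinite.Build _ _ _ rV_cons_measure
  rV_cons_measure_sigma_finite.

End rV_cons_measure.

Fixpoint lebesgue_rV (d : nat) : {sigma_finite_measure set 'rV[R]_d -> \bar R} :=
  match d with
  | 0%N => [the {sigma_finite_measure set 'rV[R]_0 -> \bar R} of \d_(0 : 'rV[R]_0)]
  | n.+1 => [the {sigma_finite_measure set 'rV[R]_n.+1 -> \bar R} of
               rV_cons_measure (lebesgue_rV n)]
  end.

End lebesgue_rV.

Section sobolev.
Context {R : realType} {d : nat}.
Implicit Types (Om : set 'rV[R]_d) (u v w g phi : 'rV[R]_d -> R)
  (al : 'I_d -> nat).

Local Notation mu := (@lebesgue_rV R d).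

Definition partial (i : 'I_d) g : 'rV[R]_d -> R :=
  fun x => 'D_(delta_mx ord0 i) g x.

Definition smooth_on Om g : Prop :=
  forall (s : seq 'I_d) (x : 'rV[R]_d), Om x ->
    {for x, continuous (foldr partial g s)} /\
    forall i, derivable (foldr partial g s) x (delta_mx ord0 i).

(* C^oo up to the boundary: all derivatives extend continuously to the
   closure. *)
Definition smooth_on_closure Om g : Prop :=
  smooth_on Om g /\
  forall s : seq 'I_d, exists h : 'rV[R]_d -> R,
    {within closure Om, continuous h} /\
    forall x, Om x -> h x = foldr partial g s x.

(* C_c^oo(Om), extended by 0 to the whole space *)
Definition test_function Om phi : Prop :=
  smooth_on setT phi /\
  compact (closure [set x | phi x != 0]) /\
  closure [set x | phi x != 0] `<=` Om.

Definition mlength al : nat := (\sum_(i < d) al i)%N.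

Definition mderiv al g : 'rV[R]_d -> R :=
  foldr (fun i h => iter (al i) (partial i) h) g (enum 'I_d).

(* Elements of L^2 and of the Sobolev spaces are represented by functions on
   the whole space, of which only the class modulo almost everywhere equality
   on Om is relevant. *)
Definition L2 Om u : Prop :=
  measurable_fun Om u /\ mu.-integrable Om (fun x => (u x ^+ 2)%:E).

Definition weak_derivative Om al u g : Prop :=
  forall phi, test_function Om phi ->
    \int[mu]_(x in Om) (u x * mderiv al phi x) =
    (-1) ^+ mlength al * \int[mu]_(x in Om) (g x * phi x).

(* A representative of the weak derivative D^al u in L^2(Om), when there is
   one. *)
Definition wderiv Om al u : 'rV[R]_d -> R :=
  xget (cst 0) [set g | L2 Om g /\ weak_derivative Om al u g].

Definition sobolev Om (k : nat) : set ('rV[R]_d -> R) :=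
  [set u | L2 Om u /\ forall al, (mlength al <= k)%N ->
    exists g, L2 Om g /\ weak_derivative Om al u g].

(* The sum ranges over the multi-indices al with |al| <= k, whose entries are
   necessarily at most k. *)
Definition sobolev_norm Om (k : nat) u : R :=
  Num.sqrt (\sum_(al : {ffun 'I_d -> 'I_k.+1} | (mlength (fun i => al i) <= k)%N)
    \int[mu]_(x in Om) (wderiv Om (fun i => al i) u x ^+ 2)).

Definition sobolev10 Om : set ('rV[R]_d -> R) :=
  [set u | sobolev Om 1 u /\ exists phi_ : ('rV[R]_d -> R)^nat,
    (forall n, test_function Om (phi_ n)) /\
    sobolev_norm Om 1 (phi_ n \- u) @[n --> \oo] --> (0 : R)].

Definition wpartial Om (i : 'I_d) u : 'rV[R]_d -> R :=
  wderiv Om (fun j => (j == i) : nat) u.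

Definition elliptic_op Om (a : 'I_d -> 'I_d -> 'rV[R]_d -> R)
    (c : 'rV[R]_d -> R) u : 'rV[R]_d -> R :=
  fun x => - (\sum_(i < d) \sum_(j < d)
                wpartial Om j (fun y => a i j y * wpartial Om i u y) x)
           + c x * u x.

Definition elliptic_coefficients Om (a : 'I_d -> 'I_d -> 'rV[R]_d -> R)
    (c : 'rV[R]_d -> R) : Prop :=
  (forall i j x, Om x -> a i j x = a j i x) /\
  (forall i j, smooth_on_closure Om (a i j)) /\
  smooth_on_closure Om c /\
  (forall x, Om x -> 0 < c x) /\
  exists theta0 : R, 0 < theta0 /\
    forall x (xi : 'rV[R]_d), Om x ->
      theta0 * \sum_(i < d) xi ord0 i ^+ 2 <=
      \sum_(i < d) \sum_(j < d) a i j x * xi ord0 i * xi ord0 j.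

(* The approximation assumption on the discrete spaces V l: the same w_l
   realises both error bounds when w is in H^m. *)
Definition approximating_spaces Om (m : nat)
    (V : nat -> set ('rV[R]_d -> R)) : Prop :=
  (forall l, V l `<=` sobolev Om 2 `&` sobolev10 Om) /\
  exists (beta : nat -> ('rV[R]_d -> R) -> R) (betat : nat -> R),
    betat l @[l --> \oo] --> (0 : R) /\
    forall w, sobolev Om 2 w -> sobolev10 Om w ->
      beta l w @[l --> \oo] --> (0 : R) /\
      exists w_ : nat -> 'rV[R]_d -> R,
        (forall l, V l (w_ l) /\
           sobolev_norm Om 2 (w_ l \- w) <= beta l w) /\
        (sobolev Om m w -> forall l,
           sobolev_norm Om 2 (w_ l \- w) <= betat l * sobolev_norm Om m w).

End sobolev.

Section consistency.
Context {R : realType} {T : Type}.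
Implicit Types (H : set (T -> R)) (N J : (T -> R) -> R) (v w : T -> R).

(* Bounded linear functionals on the linear space H with (semi)norm N. *)
Definition bounded_functional H N (F : (T -> R) -> R) : Prop :=
  (forall (t : R) v w, H v -> H w ->
     F (fun x => t * v x + w x) = t * F v + F w) /\
  exists C : R, forall v, H v -> `|F v| <= C * N v.

Definition weak_cvg H N (v_ : (T -> R)^nat) v : Prop :=
  forall F, bounded_functional H N F -> F (v_ n) @[n --> \oo] --> F v.

(* (iii) for constant sequences makes J v depend only on the class of v for
   the seminorm N. *)
Definition consistent H N J : Prop :=
  [/\ (* (i) *) forall v, H v -> 0 <= J v,
      (* (ii) *) forall (v_ : (T -> R)^nat) v, (forall n, H (v_ n)) -> H v ->
        weak_cvg H N v_ v ->
        ((J v)%:E <= limn_einf (fun n => (J (v_ n))%:E))%E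
    & (* (iii) *) forall (w_ : (T -> R)^nat) w, (forall n, H (w_ n)) -> H w ->
        N (w_ n \- w) @[n --> \oo] --> (0 : R) ->
        J (w_ n) @[n --> \oo] --> J w].

End consistency.

Section energy.
Context {R : realType} {d : nat}.
Variables (Om : set 'rV[R]_d) (a : 'I_d -> 'I_d -> 'rV[R]_d -> R).
Variables (c f : 'rV[R]_d -> R) (lambda : R) (J : ('rV[R]_d -> R) -> R).
Variable (V : nat -> set ('rV[R]_d -> R)).

Definition energy (v : 'rV[R]_d -> R) : R :=
  \int[@lebesgue_rV R d]_(x in Om) (`|elliptic_op Om a c v x - f x| ^+ 2).

Definition energy_reg (v : 'rV[R]_d -> R) : R := energy v + lambda * J v.

Definition energy_reg_disc (l : nat) (v : 'rV[R]_d -> R) : \bar R :=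
  if `[< (V l `&` sobolev Om 2 `&` sobolev10 Om) v >]
  then (energy_reg v)%:E else +oo%E.

End energy.

(* Main.v *)
Require Import Defs.
From mathcomp Require Import all_boot all_order all_algebra.
From mathcomp Require Import all_classical all_reals all_analysis.
From mathcomp Require Import measurable_realfun.
From mathcomp Require Import ring lra.

(** The energy is the sum of a quadratic functional of [L v] and of a convex
    functional, so it is strongly convex in [L v]: comparing the minimiser [u]
    with the midpoint of [u] and [v] gives

      |L (v - u)|^2 <= 2 (E_reg v - E_reg u)   in L2, for all v in H^2 and H^1_0

    ([minimiser_gap]). Apply this to the discrete minimiser [u_ l]. If [w_ l] is
    the approximation of [u] in [V l], then minimality bounds the right-hand side
    by [2 (E_reg (w_ l) - E_reg u)]. This tends to zero because [w_ l] tends to [u]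
    in H^2: [L] is bounded from H^2 to L2 ([elliptic_null], [energy_cvg]), and
    [J] is continuous for H^2 convergence by consistency. Hence [L (u_ l - u)]
    tends to zero in L2. Finally [L] is coercive on H^2 and H^1_0: Green's formula
    ([green]), ellipticity and Poincare's inequality ([poincare]) bound the H^1
    norm of [v] by a multiple of the L2 norm of [L v] ([coercive]).

    Weak derivatives are representatives chosen by [wderiv], so the linearity of
    [L], its boundedness and Green's formula all rest on the almost everywhere
    uniqueness of weak derivatives. It follows from the fundamental lemma of the
    calculus of variations ([fundamental_lemma]): products of smooth bumps
    [exp (- 1 / x)] tend to indicators of orthants, which generate the measurable
    sets. The other analytic ingredient is that the derivative of a test function
    has integral zero ([integral_partial]), by Fubini and the fundamental theorem
    of calculus; it gives integration by parts, and from it the product rule for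
    weak derivatives and Poincare's inequality. *)

Set Implicit Arguments.
Unset Strict Implicit.
Unset Printing Implicit Defensive.

Import Order.TTheory GRing.Theory Num.Theory.
Import numFieldNormedType.Exports.

Local Open Scope classical_set_scope.
Local Open Scope ring_scope.

(** * The L2 pairing *)

Section L2_pairing.
Context {R : realType} {d : nat} {Om : set 'rV[R]_d}.
Hypothesis mOm : measurable Om.
Local Notation mu := (@lebesgue_rV R d).
Implicit Types u v w g : 'rV[R]_d -> R.

Definition ip (D : set 'rV[R]_d) u v : R := \int[mu]_(x in D) (u x * v x).

Lemma L2_integrableM u v : L2 Om u -> L2 Om v ->
  mu.-integrable Om (EFin \o (fun x => u x * v x)).
Proof.
move=> [mu_ iu] [mv iv].
apply: (le_integrable mOm (g := fun x => (u x ^+ 2)%:E + (v x ^+ 2)%:E)%E) => //.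
- by apply/measurable_EFinP; exact: measurable_funM.
- move=> x Omx /=; rewrite lee_fin [leRHS]ger0_norm ?addr_ge0 ?sqr_ge0//.
  rewrite ler_norml; apply/andP; split.
    have := sqr_ge0 (u x + v x); have := sqr_ge0 (u x); have := sqr_ge0 (v x); nra.
  have := sqr_ge0 (u x - v x); have := sqr_ge0 (u x); have := sqr_ge0 (v x); nra.
- exact: integrableD.
Qed.

Lemma L2_measurable u : L2 Om u -> measurable_fun Om u.
Proof. by case. Qed.

Lemma L2P u : measurable_fun Om u ->
  mu.-integrable Om (EFin \o (fun x => u x * u x)) -> L2 Om u.
Proof. by move=> mu_ iu; split. Qed.

Lemma L2_bM (b : 'rV[R]_d -> R) (K : R) u : measurable_fun Om b ->
  (forall x, Om x -> `|b x| <= K) -> L2 Om u -> L2 Om (fun x => b x * u x).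
Proof.
move=> mb bK [mu_ iu]; split; first exact: measurable_funM.
apply: (le_integrable mOm (g := fun x => ((K ^+ 2)%:E * (u x ^+ 2)%:E)%E)).
- by apply/measurable_EFinP; apply: measurable_funX; exact: measurable_funM.
- move=> x Omx /=; rewrite lee_fin [leLHS]ger0_norm ?sqr_ge0//.
  rewrite [leRHS]ger0_norm; last by apply: mulr_ge0; exact: sqr_ge0.
  rewrite exprMn ler_wpM2r ?sqr_ge0// -(real_normK (num_real (b x))).
  by rewrite lerXn2r ?nnegrE// ?bK// (le_trans _ (bK _ Omx)).
- exact: (integrableZl mOm (K ^+ 2) iu).
Qed.

Lemma L2Z (t : R) u : L2 Om u -> L2 Om (fun x => t * u x).
Proof. by move=> Lu; apply: (@L2_bM (cst t) `|t|). Qed.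

Lemma L2D u v : L2 Om u -> L2 Om v -> L2 Om (u \+ v).
Proof.
move=> Lu Lv; apply: L2P.
  by apply: measurable_funD; apply: L2_measurable.
apply: (@eq_integrable _ _ _ mu _ mOm (((EFin \o (fun x => u x * u x)) \+
  (EFin \o (fun x => 2 * u x * v x)) \+ (EFin \o (fun x => v x * v x))))).
  by move=> x _ /=; rewrite -!EFinD; congr EFin; ring.
apply: integrableD => //; last exact: L2_integrableM.
apply: integrableD => //; first exact: L2_integrableM.
by apply: L2_integrableM => //; exact: L2Z.
Qed.

Lemma L2_lin (t : R) u v : L2 Om u -> L2 Om v -> L2 Om (fun x => t * u x + v x).
Proof. by move=> Lu Lv; apply: L2D => //; exact: L2Z. Qed.

Lemma L2B u v : L2 Om u -> L2 Om v -> L2 Om (u \- v).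
Proof.
move=> Lu Lv; have := L2_lin (-1) Lv Lu.
by congr L2; apply/funext => x /=; ring.
Qed.

Lemma L2N u : L2 Om u -> L2 Om (fun x => - u x).
Proof.
by move=> /(L2Z (-1)); congr L2; apply/funext => x /=; ring.
Qed.

Lemma L2_cst0 : L2 Om (cst 0).
Proof.
split => //; apply: (@eq_integrable _ _ _ mu _ mOm (cst 0%E)) => //.
  by move=> x _ /=; rewrite expr0n.
exact: integrable0.
Qed.

Lemma L2_sum (I : Type) (r : seq I) (F : I -> 'rV[R]_d -> R) :
  (forall i, L2 Om (F i)) -> L2 Om (fun x => \sum_(i <- r) F i x).
Proof.
move=> LF; elim: r => [|i r ih].
  have := L2_cst0; congr L2; apply/funext => x.
  by rewrite big_nil.
have := L2D (LF i) ih; congr L2; apply/funext => x /=.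
by rewrite big_cons.
Qed.

Lemma ipC D u v : ip D u v = ip D v u.
Proof. by apply: eq_Rintegral => x _; rewrite mulrC. Qed.

Lemma ip_ge0 D u : 0 <= ip D u u.
Proof. by apply: Rintegral_ge0 => x _; rewrite -expr2 sqr_ge0. Qed.

Lemma ip_sqr D u : \int[mu]_(x in D) (u x ^+ 2) = ip D u u.
Proof. by []. Qed.

Lemma ip_lin (t : R) u v w : L2 Om u -> L2 Om v -> L2 Om w ->
  ip Om (fun x => t * u x + v x) w = t * ip Om u w + ip Om v w.
Proof.
move=> Lu Lv Lw; rewrite /ip -RintegralZl//; last exact: L2_integrableM.
rewrite -RintegralD//.
- by apply: eq_Rintegral => x _; ring.
- apply: (@eq_integrable _ _ _ mu _ mOm ((EFin \o (fun x => (t * u x) * w x)))).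
    by move=> x _ /=; rewrite mulrA.
  by apply: L2_integrableM => //; exact: L2Z.
- exact: L2_integrableM.
Qed.

Lemma ipD u v w : L2 Om u -> L2 Om v -> L2 Om w ->
  ip Om (u \+ v) w = ip Om u w + ip Om v w.
Proof.
move=> Lu Lv Lw; rewrite -[ip Om u w]mul1r -ip_lin//.
by congr ip; apply/funext => x /=; rewrite mul1r.
Qed.

Lemma ipB u v w : L2 Om u -> L2 Om v -> L2 Om w ->
  ip Om (u \- v) w = ip Om u w - ip Om v w.
Proof.
move=> Lu Lv Lw; rewrite addrC -[- _]mulN1r -ip_lin//.
by congr ip; apply/funext => x /=; ring.
Qed.

Lemma ipDr u v w : L2 Om u -> L2 Om v -> L2 Om w ->
  ip Om w (u \+ v) = ip Om w u + ip Om w v.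
Proof. by move=> *; rewrite ![ip Om w _]ipC ipD. Qed.

Lemma ipBr u v w : L2 Om u -> L2 Om v -> L2 Om w ->
  ip Om w (u \- v) = ip Om w u - ip Om w v.
Proof. by move=> *; rewrite ![ip Om w _]ipC ipB. Qed.

Lemma ipZ (t : R) u w : L2 Om u -> L2 Om w ->
  ip Om (fun x => t * u x) w = t * ip Om u w.
Proof.
move=> Lu Lw; rewrite /ip -RintegralZl//; last exact: L2_integrableM.
by apply: eq_Rintegral => x _; ring.
Qed.

Lemma ipN u w : L2 Om u -> L2 Om w -> ip Om (fun x => - u x) w = - ip Om u w.
Proof.
move=> Lu Lw; rewrite -[RHS]mulN1r -ipZ//.
by congr ip; apply/funext => x; rewrite mulN1r.
Qed.

Lemma ip_sum (I : Type) (r : seq I) (F : I -> 'rV[R]_d -> R) w :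
  (forall i, L2 Om (F i)) -> L2 Om w ->
  ip Om (fun x => \sum_(i <- r) F i x) w = \sum_(i <- r) ip Om (F i) w.
Proof.
move=> LF Lw; elim: r => [|i r ih].
  rewrite big_nil /ip (@eq_Rintegral _ _ _ _ _ (cst 0)) ?Rintegral_cst ?mul0r//.
  by move=> x _; rewrite /= big_nil mul0r.
rewrite big_cons -ih -ipD//; last exact: L2_sum.
by congr ip; apply/funext => x; rewrite big_cons.
Qed.

Lemma ip_ae u u' v v' : measurable_fun Om u -> measurable_fun Om u' ->
  measurable_fun Om v -> measurable_fun Om v' ->
  ae_eq mu Om u u' -> ae_eq mu Om v v' -> ip Om u v = ip Om u' v'.
Proof.
move=> m1 m2 m3 m4 uu vv; congr fine; apply: ae_eq_integral => //.
- by apply/measurable_EFinP; exact: measurable_funM.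
- by apply/measurable_EFinP; exact: measurable_funM.
- by move: uu vv; apply: filterS2 => x ux vx Dx; rewrite ux// vx.
Qed.

(** The square of [ip v v * u - ip u v * v] is nonnegative, and for a nonzero
    [v] it is a positive multiple of the difference of the two sides. *)
Lemma cauchy_schwarz u v : L2 Om u -> L2 Om v ->
  ip Om u v ^+ 2 <= ip Om u u * ip Om v v.
Proof.
move=> Lu Lv.
have pos (s t : R) : 0 <= s ^+ 2 * ip Om u u + 2 * s * t * ip Om u v
    + t ^+ 2 * ip Om v v.
  have L1 : L2 Om (fun x => t * v x) by exact: L2Z.
  have L3 : L2 Om (fun x => s * u x + t * v x) by exact: L2_lin.
  have := ip_ge0 Om (fun x => s * u x + t * v x).
  rewrite ip_lin// ipZ//.
  rewrite ![ip Om _ (fun x => s * _ + _)]ipC !ip_lin// !ipZ// (ipC _ v u).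
  by congr (0 <= _); ring.
have [v0|v0] := eqVneq (ip Om v v) 0.
  (* for a null [v], the square with [s = 1] is affine in [t] *)
  have [uv0|uv0] := eqVneq (ip Om u v) 0; first by rewrite uv0 v0 mulr0 expr0n.
  have := pos 1 (- (ip Om u u + 1) / (2 * ip Om u v)).
  rewrite v0 mulr0 addr0 (_ : _ + _ = -1); first by rewrite ler0N1.
  by field.
have vp : 0 < ip Om v v by rewrite lt_neqAle eq_sym v0 ip_ge0.
have := pos (ip Om v v) (- ip Om u v).
rewrite (_ : _ + _ = ip Om v v * (ip Om u u * ip Om v v - ip Om u v ^+ 2)).
  by rewrite pmulr_rge0// subr_ge0.
by ring.
Qed.

Lemma ip_young (e : R) u v : 0 < e -> L2 Om u -> L2 Om v ->
  2 * ip Om u v <= e^-1 * ip Om u u + e * ip Om v v.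
Proof.
move=> e0 Lu Lv.
have L1 : L2 Om (fun x => - e * v x) by exact: L2Z.
have L2' : L2 Om (fun x => 1 * u x + - e * v x) by exact: L2_lin.
have := ip_ge0 Om (fun x => 1 * u x + - e * v x).
rewrite ip_lin// ipZ// ![ip Om _ (fun x => 1 * _ + _)]ipC !ip_lin// !ipZ//.
rewrite (ipC _ v u) => h.
rewrite -subr_ge0 -(pmulr_rge0 _ e0); move: h; congr (0 <= _).
by field; rewrite gt_eqF.
Qed.

Lemma ip_sqrD u v : L2 Om u -> L2 Om v ->
  ip Om (u \+ v) (u \+ v) <= 2 * ip Om u u + 2 * ip Om v v.
Proof.
move=> Lu Lv; have L1 := L2D Lu Lv; rewrite ipD// !ipDr//.
by have := ip_young ltr01 Lu Lv; rewrite invr1 (ipC _ v u); lra.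
Qed.

Lemma cvg0_sqr (F : (R)^nat) : (F n ^+ 2) @[n --> \oo] --> (0 : R) ->
  F n @[n --> \oo] --> (0 : R).
Proof.
move=> h; apply/norm_cvg0P.
have := cvg_comp _ _ h (@sqrt_continuous R 0).
rewrite sqrtr0; apply: cvg_trans; apply: near_eq_cvg.
by apply: nearW => n /=; rewrite sqrtr_sqr.
Qed.

Lemma ip_cvg g (p : nat -> 'rV[R]_d -> R) q : L2 Om g -> (forall n, L2 Om (p n)) ->
  L2 Om q -> ip Om (p n \- q) (p n \- q) @[n --> \oo] --> (0 : R) ->
  ip Om g (p n) @[n --> \oo] --> ip Om g q.
Proof.
move=> Lg Lp Lq pq; apply/subr_cvg0; apply: cvg0_sqr.
apply: (@squeeze_cvgr _ _ _ _ (fun=> 0)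
   (fun n => ip Om g g * ip Om (p n \- q) (p n \- q))).
- apply: nearW => n; rewrite sqr_ge0/= -ipBr//; apply: cauchy_schwarz => //.
  exact: L2B.
- exact: cvg_cst.
- by rewrite -(mulr0 (ip Om g g)); apply: cvgZr.
Qed.

Lemma ip_cvg_sqr (p : nat -> 'rV[R]_d -> R) q : (forall n, L2 Om (p n)) ->
  L2 Om q -> ip Om (p n \- q) (p n \- q) @[n --> \oo] --> (0 : R) ->
  ip Om (p n) (p n) @[n --> \oo] --> ip Om q q.
Proof.
move=> Lp Lq pq.
have h := ip_cvg Lq Lp Lq pq.
rewrite (_ : ip Om q q = 0 + 2 * ip Om q q - ip Om q q); last by ring.
rewrite (_ : (fun n => ip Om (p n) (p n)) = (fun n =>
  ip Om (p n \- q) (p n \- q) + 2 * ip Om q (p n) - ip Om q q)).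
  by apply: cvgB; [apply: cvgD => //; exact: cvgZr|exact: cvg_cst].
apply/funext => n; have := L2B (Lp n) Lq => L.
by rewrite ipB// !ipBr// (ipC _ q (p n)); ring.
Qed.

Lemma ip_sqr_bM (b : 'rV[R]_d -> R) (K : R) u : measurable_fun Om b ->
  (forall x, Om x -> `|b x| <= K) -> L2 Om u ->
  ip Om (fun x => b x * u x) (fun x => b x * u x) <= K ^+ 2 * ip Om u u.
Proof.
move=> mb bK Lu; rewrite /ip -RintegralZl//; last exact: L2_integrableM.
have Lbu := L2_bM mb bK Lu.
apply: le_Rintegral => //; first exact: L2_integrableM.
  by have := integrableZl mOm (K ^+ 2) (L2_integrableM Lu Lu).
move=> x Omx; rewrite -!expr2 exprMn ler_wpM2r ?sqr_ge0//.
rewrite -(real_normK (num_real (b x))).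
by rewrite lerXn2r ?nnegrE// ?bK// (le_trans _ (bK _ Omx)).
Qed.

End L2_pairing.

(** * Boxes, open sets and measurability in R^d *)

Section boxes.
Context {R : realType} {d : nat}.
Local Notation mu := (@lebesgue_rV R d).
Implicit Types (p q : 'I_d -> R) (Om : set 'rV[R]_d) (g : 'rV[R]_d -> R).

Definition open_box p q : set 'rV[R]_d :=
  [set x | forall i, p i < x ord0 i < q i].

Definition closed_box p q : set 'rV[R]_d :=
  [set x | forall i, p i <= x ord0 i <= q i].

Lemma measurable_coord_preimage (B : 'I_d -> set R) :
  (forall i, measurable (B i)) ->
  measurable [set x : 'rV[R]_d | forall i, B i (x ord0 i)].
Proof.
move=> mB.
rewrite (_ : [set x | _] =
    \bigcap_(i in [set: 'I_d]) ((fun x : 'rV[R]_d => x ord0 i) @^-1` B i)).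
  apply: fin_bigcap_measurable => // i _.
  by rewrite -[X in measurable X]setTI; exact: measurable_coord.
by apply/seteqP; split => x /= h i; [move=> _|]; exact: h.
Qed.

Lemma measurable_open_box p q : measurable (open_box p q).
Proof.
have := @measurable_coord_preimage (fun i => [set` `]p i, q i[]).
apply => i; exact: measurable_itv.
Qed.

(** Rational boxes make the cover of [Om] countable; the closed box lies in
    [Om] so that it can carry a compact support. *)
Lemma open_box_nbhs Om (x : 'rV[R]_d) : open Om -> Om x ->
  exists pq : {ffun 'I_d -> rat} * {ffun 'I_d -> rat},
    open_box (ratr \o pq.1) (ratr \o pq.2) x /\
    closed_box (ratr \o pq.1) (ratr \o pq.2) `<=` Om.
Proof.
move=> oOm Omx; have /nbhs_ballP[e /= e0 eOm] : nbhs x Om by exact: open_nbhs_nbhs.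
have hp i : exists q : rat, ratr q \in `]x ord0 i - e, x ord0 i[.
  by apply: rat_in_itvoo; rewrite ltrBlDr ltrDl.
have hq i : exists q : rat, ratr q \in `]x ord0 i, x ord0 i + e[.
  by apply: rat_in_itvoo; rewrite ltrDl.
have [p Hp] := choice hp; have [q Hq] := choice hq.
exists ([ffun i => p i], [ffun i => q i]); split.
  move=> i /=; rewrite !ffunE.
  by move: (Hp i) (Hq i); rewrite !in_itv/= => /andP[_ ->] /andP[-> _].
move=> y hy; apply: eOm; split => // j i; rewrite (ord1 j).
move: (Hp i) (Hq i) (hy i); rewrite !in_itv/= !ffunE /ball/= ltr_distlC.
by move=> /andP[? ?] /andP[? ?] /andP[? ?]; apply/andP; split; lra.
Qed.

(** The measurable sets are generated by the coordinates, not by the open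
    sets; the two agree because an open set is a countable union of boxes. *)
Lemma open_rV_measurable Om : open Om -> measurable Om.
Proof.
move=> oOm; pose F (pq : {ffun 'I_d -> rat} * {ffun 'I_d -> rat}) :=
  if `[< closed_box (ratr \o pq.1) (ratr \o pq.2) `<=` Om >]
  then open_box (ratr \o pq.1) (ratr \o pq.2) : set 'rV[R]_d else set0.
rewrite (_ : Om = \bigcup_pq F pq).
  apply: countable_bigcupT_measurable => // pq.
  by rewrite /F; case: ifP => // _; exact: measurable_open_box.
apply/seteqP; split => x.
  move=> /(open_box_nbhs oOm)[pq [xpq pqOm]]; exists pq => //.
  by rewrite /F ifT//; exact/asboolP.
move=> [pq _]; rewrite /F; case: asboolP => // pqOm hx; apply: pqOm => i.
by have /andP[/ltW -> /ltW ->] := hx i.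
Qed.

Lemma continuous_on_measurable Om g : open Om ->
  (forall x, Om x -> {for x, continuous g}) -> measurable_fun Om g.
Proof.
move=> oOm cg; apply: (measurability _ (RGenOpens.measurableE R)).
move=> _ [_ [a [b ->]] <-]; apply: open_rV_measurable.
rewrite openE => x [Omx gx]; rewrite /interior.
apply: filterI; first exact: open_nbhs_nbhs.
by apply: (cg x Omx); apply: open_nbhs_nbhs; split => //; exact: interval_open.
Qed.

Lemma continuous_rV_measurable g : continuous g -> measurable_fun setT g.
Proof.
move=> cg; apply: continuous_on_measurable; first exact: openT.
by move=> x _; exact: cg.
Qed.

End boxes.

Section finite_measure.
Context {R : realType}.

Definition cube (d : nat) (M : R) : set 'rV[R]_d :=
  [set x | forall i, `|x ord0 i| <= M].

Lemma measurable_cube (d : nat) (M : R) : measurable (@cube d M).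
Proof.
have := @measurable_coord_preimage R d (fun i => [set` `[-M, M]]).
rewrite (_ : [set x | _] = @cube d M).
  by apply => i; exact: measurable_itv.
by apply/seteqP; split => x /= h i; have := h i; rewrite in_itv/= -ler_norml.
Qed.

Lemma cube_measure_fin (d : nat) (M : R) :
  (@lebesgue_rV R d (@cube d M) < +oo)%E.
Proof.
elim: d => [|d ih] /=.
  by rewrite diracE; case: (_ \in _); rewrite /= ltry.
rewrite /rV_cons_measure /pushforward.
rewrite (_ : _ @^-1` _ = [set` `[-M, M]] `*` @cube d M).
  rewrite product_measure1E//; last exact: measurable_cube.
  rewrite lte_mul_pinfty//.
  rewrite [X in X \is a fin_num](lebesgue_measure_itv `[- M, M])/=.
  by case: ifP => // _; rewrite -EFinB.
apply/seteqP; split => -[t y] /=.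
  move=> h; split.
    by have := h ord0; rewrite /rV_cons mxE unlift_none/= in_itv/= ler_norml.
  by move=> i; have := h (lift ord0 i); rewrite /rV_cons mxE liftK.
move=> [+ h] i; rewrite /rV_cons mxE in_itv/= -ler_norml.
by case: unliftP => [j _|_].
Qed.

Lemma rV_coord_le_norm (d : nat) (x : 'rV[R]_d) i : `|x ord0 i| <= `|x|.
Proof.
rewrite [leRHS]/Num.Def.normr /= mx_normrE; apply/bigmax_geP; right => /=.
by exists (ord0, i).
Qed.

Lemma bounded_set_coord (d : nat) (Om : set 'rV[R]_d) : bounded_set Om ->
  exists2 M : R, 0 < M & forall x, Om x -> forall i, `|x ord0 i| <= M.
Proof.
move=> [M [_ hM]]; exists (`|M| + 1); first by rewrite ltr_wpDl.
move=> x /(hM (`|M| + 1)) h i; apply: le_trans (rV_coord_le_norm _ _) (h _).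
by rewrite (le_lt_trans (ler_norm _))// ltrDl.
Qed.

Lemma bounded_measure_fin (d : nat) (Om : set 'rV[R]_d) : measurable Om ->
  bounded_set Om -> (@lebesgue_rV R d Om < +oo)%E.
Proof.
move=> mOm /bounded_set_coord[M _ hM].
apply: le_lt_trans (cube_measure_fin d M); apply: le_measure => //; rewrite inE//.
by exact: measurable_cube.
Qed.

End finite_measure.

(** * Smooth functions *)

Section smooth.
Context {R : realType} {d : nat}.
Implicit Types (Om U : set 'rV[R]_d) (g h u v phi : 'rV[R]_d -> R).

Local Notation e_ i := (delta_mx ord0 i : 'rV[R]_d).

Lemma near_open Om (P : set 'rV[R]_d) (x : 'rV[R]_d) : open Om -> Om x ->
  (forall y, Om y -> P y) -> \forall y \near x, P y.
Proof.
move=> oOm Omx OmP; apply: (@filterS _ (nbhs x) _ Om) => //.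
exact: open_nbhs_nbhs.
Qed.

Lemma near_eq_continuous g h (x : 'rV[R]_d) : (\near x, g x = h x) ->
  {for x, continuous g} -> {for x, continuous h}.
Proof.
move=> gh cg; have gx := nbhs_singleton gh.
have cg' : g y @[y --> x] --> h x by rewrite -gx; exact: cg.
apply: cvg_trans cg'; exact: (@near_eq_cvg _ _ (nbhs x) _ g h gh).
Qed.

(** Coinduction for smoothness: a family that is closed under differentiation
    on [Om], and whose members are merely continuous and once
    differentiable, contains all the
    iterated derivatives of its members. Equality on [Om] is enough because [Om]
    is open and derivatives are local. *)
Lemma smooth_on_coind (S : set ('rV[R]_d -> R)) Om : open Om ->
  (forall g, S g -> forall x, Om x ->
     {for x, continuous g} /\ forall i, derivable g x (e_ i)) ->
  (forall g, S g -> forall i, exists2 h, S h &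
     forall x, Om x -> partial i g x = h x) ->
  forall g, S g -> smooth_on Om g.
Proof.
move=> oOm Sreg Sder g Sg s.
have [h Sh gh] : exists2 h, S h & forall x, Om x -> foldr partial g s x = h x.
  elim: s => [|i s [h Sh gh]]; first by exists g.
  have [k Sk hk] := Sder h Sh i; exists k => // x Omx.
  by rewrite -hk//=; apply: near_eq_derive; exact: near_open gh.
move=> x Omx; have [ch dh] := Sreg h Sh x Omx.
have hg : \near x, h x = foldr partial g s x.
  by apply: (near_open oOm Omx) => y Omy; rewrite gh.
split; first exact: near_eq_continuous hg ch.
by move=> i; apply: near_eq_derivable (hg) (dh i).
Qed.

Inductive generated_algebra (S : set ('rV[R]_d -> R)) : set ('rV[R]_d -> R) :=
| alg_base g of S g : generated_algebra S g
| alg_cst c : generated_algebra S (cst c)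
| alg_add g h of generated_algebra S g & generated_algebra S h :
    generated_algebra S (g + h)
| alg_mul g h of generated_algebra S g & generated_algebra S h :
    generated_algebra S (g * h).

(** By the Leibniz rule an algebra is closed under differentiation as soon as
    the derivatives of its generators lie in it. This proves at once that
    products of smooth functions are smooth (generators: all the derivatives of
    the factors) and that bump functions are (generators: the flat ridges
    below). *)
Lemma smooth_on_generated (S : set ('rV[R]_d -> R)) Om : open Om ->
  (forall g, S g -> forall x, Om x ->
     {for x, continuous g} /\ forall i, derivable g x (e_ i)) ->
  (forall g, S g -> forall i, exists2 h, generated_algebra S h &
     forall x, Om x -> partial i g x = h x) ->
  forall g, generated_algebra S g -> smooth_on Om g.
Proof.
move=> oOm Sreg Sder.
have reg g : generated_algebra S g -> forall x, Om x ->
    {for x, continuous g} /\ forall i, derivable g x (e_ i).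
  elim=> [{}g Sg|c|{}g h _ ihg _ ihh|{}g h _ ihg _ ihh] x Omx.
  - exact: Sreg.
  - by split => [|i]; [exact: cst_continuous|exact: derivable_cst].
  - have [cg dg] := ihg x Omx; have [ch dh] := ihh x Omx.
    by split => [|i]; [exact: continuousD|exact: derivableD].
  - have [cg dg] := ihg x Omx; have [ch dh] := ihh x Omx.
    by split => [|i]; [exact: continuousM|exact: derivableM].
apply: smooth_on_coind => // g; elim=> [{}g Sg|c|{}g h Ag ihg Ah ihh|{}g h Ag ihg Ah ihh] i.
- exact: Sder.
- exists (cst 0); first exact: alg_cst.
  by move=> x _; rewrite /partial derive_cst.
- have [g' Ag' gg'] := ihg i; have [h' Ah' hh'] := ihh i.
  exists (g' + h'); first exact: alg_add.
  move=> x Omx; have [_ dg] := reg _ Ag x Omx; have [_ dh] := reg _ Ah x Omx.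
  by rewrite /partial deriveD//; congr (_ + _); [exact: gg'|exact: hh'].
- have [g' Ag' gg'] := ihg i; have [h' Ah' hh'] := ihh i.
  exists (g * h' + h * g'); first by apply: alg_add; apply: alg_mul.
  move=> x Omx; have [_ dg] := reg _ Ag x Omx; have [_ dh] := reg _ Ah x Omx.
  rewrite /partial deriveM//; congr (_ * _ + _ * _); [exact: hh'|exact: gg'].
Qed.

Lemma smooth_on_continuous Om g : smooth_on Om g ->
  forall x, Om x -> {for x, continuous g}.
Proof. by move=> sg x /(sg [::])[]. Qed.

Lemma smooth_on_derivable Om g : smooth_on Om g ->
  forall x, Om x -> forall i, derivable g x (e_ i).
Proof. by move=> sg x /(sg [::])[]. Qed.

Lemma smooth_on_foldr Om g s : smooth_on Om g -> smooth_on Om (foldr partial g s).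
Proof. by move=> sg t x Omx; rewrite -foldr_cat; exact: sg. Qed.

Lemma smooth_on_partial Om g i : smooth_on Om g -> smooth_on Om (partial i g).
Proof. exact: (@smooth_on_foldr Om g [:: i]). Qed.

Lemma smooth_on_setU U1 U2 g : smooth_on U1 g -> smooth_on U2 g ->
  smooth_on (U1 `|` U2) g.
Proof. by move=> s1 s2 s x [/s1|/s2]; apply. Qed.

Lemma smooth_on_subset U1 U2 g : U1 `<=` U2 -> smooth_on U2 g -> smooth_on U1 g.
Proof. by move=> U12 s2 s x /U12 /s2; apply. Qed.

Lemma foldr_partial_algebra Om g h k : open Om -> smooth_on Om g ->
  smooth_on Om h -> generated_algebra
    [set f | exists s, f = foldr partial g s \/ f = foldr partial h s] k ->
  smooth_on Om k.
Proof.
move=> oOm sg sh; apply: smooth_on_generated => // f [s [->|->]].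
- exact: sg.
- exact: sh.
- move=> i; exists (foldr partial g (i :: s)) => //.
  by apply: alg_base; exists (i :: s); left.
- move=> i; exists (foldr partial h (i :: s)) => //.
  by apply: alg_base; exists (i :: s); right.
Qed.

Lemma smooth_onD Om g h : open Om -> smooth_on Om g -> smooth_on Om h ->
  smooth_on Om (g + h).
Proof.
move=> oOm sg sh; apply: (foldr_partial_algebra oOm sg sh).
by apply: alg_add; apply: alg_base; exists [::]; [left|right].
Qed.

Lemma smooth_onM Om g h : open Om -> smooth_on Om g -> smooth_on Om h ->
  smooth_on Om (g * h).
Proof.
move=> oOm sg sh; apply: (foldr_partial_algebra oOm sg sh).
by apply: alg_mul; apply: alg_base; exists [::]; [left|right].
Qed.

Lemma smooth_on_cst Om c : open Om -> smooth_on Om (cst c).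
Proof.
move=> oOm; apply: (@smooth_on_generated set0) => //; exact: alg_cst.
Qed.

Lemma smooth_on_eq Om g h : open Om -> (forall x, Om x -> g x = h x) ->
  smooth_on Om g -> smooth_on Om h.
Proof.
move=> oOm gh sg; apply: (@smooth_on_coind
  [set f | exists s, forall x, Om x -> foldr partial g s x = f x]) => //; last first.
- by exists [::].
- move=> f [s sf] i; exists (foldr partial g (i :: s)); first by exists (i :: s).
  move=> x Omx; apply: near_eq_derive.
  apply: (near_open oOm Omx) => y Omy; exact/esym/sf.
- move=> f [s sf] x Omx; have [cs ds] := sg s x Omx.
  have gf : \near x, foldr partial g s x = f x by exact: near_open sf.
  split; first exact: near_eq_continuous gf cs.
  by move=> i; apply: near_eq_derivable (gf) (ds i).
Qed.

Lemma smooth_on_prod Om (I : Type) (r : seq I) (F : I -> 'rV[R]_d -> R) :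
  open Om -> (forall i, smooth_on Om (F i)) ->
  smooth_on Om (fun x => \prod_(i <- r) F i x).
Proof.
move=> oOm sF; elim: r => [|i r ih].
  apply: (smooth_on_eq _ _ (@smooth_on_cst Om 1 oOm)) => // x _.
  by rewrite big_nil.
apply: (smooth_on_eq _ _ (smooth_onM oOm (sF i) ih)) => // x _.
by rewrite big_cons.
Qed.

Lemma is_derive_line g (x v : 'rV[R]_d) (t : R) :
  derivable g (x + t *: v) v ->
  is_derive t 1 (fun s => g (x + s *: v)) ('D_v g (x + t *: v)).
Proof.
move=> dg.
have eqf : (fun h : R => h^-1 *: (((fun s => g (x + s *: v)) \o shift t) (h *: 1) -
     g (x + t *: v))) =
   (fun h : R => h^-1 *: ((g \o shift (x + t *: v)) (h *: v) - g (x + t *: v))).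
  apply/funext => h /=; congr (_ *: (g _ - _)).
  by rewrite [h *: 1]mulr1 scalerDl addrCA.
split; last by rewrite /derive eqf.
by rewrite /derivable eqf.
Qed.

Lemma MVT_line (F F' : R -> R) (h : R) : 0 < h ->
  (forall t : R, is_derive t (1 : R) F (F' t)) ->
  exists s, [/\ 0 < s, s < h & F h - F 0 = h * F' s].
Proof.
move=> h0 dF.
have [|s] := @MVT R F F' 0 h h0 (fun t _ => dF t).
  by apply: derivable_within_continuous => t _; have [] := dF t.
by rewrite subr0 mulrC in_itv/= => /andP[s0 sh] ->; exists s.
Qed.

(** The mean value theorem, in the direction [v] and then in the direction [w].
    The left-hand side is symmetric in [v] and [w], whence the equality of the
    mixed derivatives. *)
Lemma second_difference phi (x : 'rV[R]_d) (v w : 'rV[R]_d) (h : R) : 0 < h ->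
  (forall y, derivable phi y v) -> (forall y, derivable ('D_v phi) y w) ->
  exists s t, [/\ 0 < s < h, 0 < t < h &
    phi (x + h *: w + h *: v) - phi (x + h *: v) - (phi (x + h *: w) - phi x) =
    h * (h * 'D_w ('D_v phi) (x + s *: v + t *: w))].
Proof.
move=> h0 dphi ddphi.
have [|s [s0 sh Es]] := @MVT_line
   (fun s => phi (x + h *: w + s *: v) - phi (x + s *: v))
   (fun s => 'D_v phi (x + h *: w + s *: v) - 'D_v phi (x + s *: v)) h h0.
  by move=> t; apply: is_deriveB; apply: is_derive_line.
have [|t [t0 th Et]] := @MVT_line (fun t => 'D_v phi (x + s *: v + t *: w))
   (fun t => 'D_w ('D_v phi) (x + s *: v + t *: w)) h h0.
  by move=> t; apply: is_derive_line.
exists s, t; rewrite s0 sh t0 th; split => //.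
rewrite -Et scale0r addr0 (addrAC x (s *: v)) -Es scale0r !addr0.
by [].
Qed.

Lemma mixed_derivatives phi (x v w : 'rV[R]_d) :
  (forall y, derivable phi y v) -> (forall y, derivable phi y w) ->
  (forall y, derivable ('D_v phi) y w) -> (forall y, derivable ('D_w phi) y v) ->
  {for x, continuous ('D_w ('D_v phi))} -> {for x, continuous ('D_v ('D_w phi))} ->
  'D_w ('D_v phi) x = 'D_v ('D_w phi) x.
Proof.
move=> dv dw dvw dwv cvw cwv; apply/eqP; rewrite -subr_eq0 -normr_le0.
apply/ler_addgt0Pr => e e0; rewrite add0r.
have e2 : 0 < e / 2 by rewrite divr_gt0.
have /cvgrPdist_le /(_ _ e2) /nbhs_ballP[r1 /= r10 h1] := cvw.
have /cvgrPdist_le /(_ _ e2) /nbhs_ballP[r2 /= r20 h2] := cwv.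
pose r := Num.min r1 r2.
have r0 : 0 < r by rewrite lt_min r10.
pose N := 1 + `|v| + `|w|.
have rr1 : r <= r1 by rewrite /r ge_min lexx.
have rr2 : r <= r2 by rewrite /r ge_min lexx orbT.
have N0 : 0 < N by rewrite /N -addrA ltr_pwDl.
(* the steps along [v] and [w], of length at most [h], stay within [r] *)
pose h := r / N.
have h0 : 0 < h by rewrite divr_gt0.
have inb s t : 0 < s < h -> 0 < t < h -> `|s *: v + t *: w| < r.
  move=> /andP[s0 sh] /andP[t0 th].
  apply: (@le_lt_trans _ _ (h * (`|v| + `|w|))).
    rewrite mulrDr (le_trans (ler_normD _ _))// !normrZ !gtr0_norm//.
    by rewrite lerD// ler_wpM2r// ltW.
  rewrite /h mulrAC ltr_pdivrMr// ltr_pM2l// /N; lra.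
have [s [t [hs ht E1]]] := second_difference x h0 dv dvw.
have [s' [t' [hs' ht' E2]]] := second_difference x h0 dw dwv.
have E : 'D_w ('D_v phi) (x + s *: v + t *: w) =
    'D_v ('D_w phi) (x + s' *: w + t' *: v).
  apply: (mulfI (lt0r_neq0 h0)); apply: (mulfI (lt0r_neq0 h0)).
  apply: etrans (esym E1) _; apply: etrans E2.
  rewrite (addrAC x (h *: w)) !opprB addrACA [RHS]addrACA.
  by congr (_ + _); exact: addrC.
have b1 := inb _ _ hs ht; have b2 := inb _ _ ht' hs'.
have k1 := h1 (x + s *: v + t *: w).
have k2 := h2 (x + s' *: w + t' *: v).
apply: le_trans (_ : e / 2 + e / 2 <= _); last by rewrite -splitr.
rewrite -[X in `|X|](subrKA ('D_w ('D_v phi) (x + s *: v + t *: w))).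
apply: le_trans (ler_normD _ _) _; apply: lerD.
  apply: k1; rewrite -ball_normE /= -addrA opprD addNKr normrN.
  exact: lt_le_trans b1 rr1.
rewrite distrC E; apply: k2; rewrite -ball_normE /= -addrA opprD addNKr normrN addrC.
exact: lt_le_trans b2 rr2.
Qed.

(** Schwarz' theorem. It is needed because a multi-index fixes the order of
    differentiation, while the elliptic operator meets the mixed derivatives in
    both orders. *)
Lemma partialC g i j : smooth_on setT g ->
  partial i (partial j g) = partial j (partial i g).
Proof.
move=> sg; apply/funext => x; apply: mixed_derivatives.
- by move=> y; apply: (smooth_on_derivable sg).
- by move=> y; apply: (smooth_on_derivable sg).
- by move=> y; apply: (smooth_on_derivable (smooth_on_partial j sg)).
- by move=> y; apply: (smooth_on_derivable (smooth_on_partial i sg)).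
- by have [] := sg [:: i; j] x I.
- by have [] := sg [:: j; i] x I.
Qed.

End smooth.

(** * Test functions *)

Section test_functions.
Context {R : realType} {d : nat}.
Implicit Types (Om U : set 'rV[R]_d) (a g h u v phi psi : 'rV[R]_d -> R).
Local Notation mu := (@lebesgue_rV R d).

Local Notation e_ i := (delta_mx ord0 i : 'rV[R]_d).
Local Notation supp phi := (closure [set x | phi x != 0]).

Lemma closure_min (A B : set 'rV[R]_d) : closed B -> A `<=` B -> closure A `<=` B.
Proof. by move=> /closure_id {2}-> AB; exact: closureS. Qed.

Lemma test_smooth Om phi : test_function Om phi -> smooth_on setT phi.
Proof. by case. Qed.

Lemma test_out Om phi x : test_function Om phi -> ~ Om x -> phi x = 0.
Proof.
move=> [_ [_ sOm]] nOmx; apply/eqP/negPn/negP => px; apply: nOmx; apply: sOm.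
exact: subset_closure.
Qed.

Lemma supp_near0 phi (x : 'rV[R]_d) : ~ supp phi x -> \near x, 0 = phi x.
Proof.
move=> nsx; have oC : open (~` supp phi) by exact/closed_openC/closed_closure.
apply: (near_open oC nsx) => y /= nsy; apply/esym/eqP/negPn/negP => py.
by apply: nsy; exact: subset_closure.
Qed.

Lemma partial_supp phi i x : partial i phi x != 0 -> supp phi x.
Proof.
move=> px; apply: contrapT => /supp_near0 n0.
move/eqP: px; apply.
rewrite /partial -(near_eq_derive _ (f := cst 0))//.
by rewrite derive_cst.
Qed.

Lemma test_supp Om phi psi : test_function Om phi -> smooth_on setT psi ->
  (forall x, psi x != 0 -> supp phi x) -> test_function Om psi.
Proof.
move=> [_ [cphi sOm]] spsi psiphi.
have sub : supp psi `<=` supp phi.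
  by apply: closure_min; [exact: closed_closure|exact: psiphi].
split => //; split; last exact: subset_trans sOm.
by apply: subclosed_compact cphi sub; exact: closed_closure.
Qed.

Lemma test_partial Om phi i : test_function Om phi -> test_function Om (partial i phi).
Proof.
move=> tphi; apply: (test_supp tphi); first exact: smooth_on_partial (test_smooth tphi).
by move=> x; exact: partial_supp.
Qed.

Lemma test_foldr Om phi s : test_function Om phi ->
  test_function Om (foldr partial phi s).
Proof. by move=> tphi; elim: s => [//|i s ih] /=; exact: test_partial. Qed.

(** Off the support of [phi] the product vanishes identically, so [a] needs to
    be smooth on [Om] only. *)
Lemma test_mul Om a phi : open Om -> smooth_on Om a -> test_function Om phi ->
  test_function Om (a * phi).
Proof.
move=> oOm sa tphi; have [sphi [cphi sOm]] := tphi.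
apply: (test_supp tphi); last first.
  move=> x; rewrite mulf_eq0 negb_or => /andP[_ px].
  exact: subset_closure.
have -> : setT = Om `|` ~` supp phi.
  apply/esym; rewrite -subTset => x _.
  by have [/sOm|] := pselect (supp phi x); [left|right].
apply: smooth_on_setU.
  exact: (smooth_onM oOm sa (smooth_on_subset (@subsetT _ Om) sphi)).
have oC : open (~` supp phi) by exact/closed_openC/closed_closure.
apply: (smooth_on_eq oC _ (smooth_on_cst 0 oC)) => x nsx /=.
rewrite (_ : (a * phi) x = a x * phi x)//.
by rewrite -(nbhs_singleton (supp_near0 nsx)) mulr0.
Qed.

Lemma test_lin Om (t : R) phi psi : test_function Om phi -> test_function Om psi ->
  test_function Om (fun x => t * phi x + psi x).
Proof.
move=> [sphi [cphi phiOm]] [spsi [cpsi psiOm]].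
have sub : supp (fun x => t * phi x + psi x) `<=` supp phi `|` supp psi.
  apply: closure_min; first by apply: closedU; exact: closed_closure.
  move=> x /= px; have [p0|p0] := eqVneq (phi x) 0.
    right; apply: subset_closure => /=; apply: contra px => /eqP ->.
    by rewrite p0 mulr0 addr0.
  by left; exact: subset_closure.
split.
  exact: (smooth_onD openT (smooth_onM openT (smooth_on_cst t openT) sphi) spsi).
split; last by apply: subset_trans sub _; rewrite subUset.
apply: subclosed_compact sub; first exact: closed_closure.
exact: compactU.
Qed.

Lemma test_continuous Om phi : test_function Om phi -> continuous phi.
Proof. by move=> tphi x; apply: (smooth_on_continuous (test_smooth tphi)). Qed.

Lemma test_measurable Om phi : test_function Om phi -> measurable_fun setT phi.
Proof. by move=> /test_continuous; exact: continuous_rV_measurable. Qed.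

Lemma test_bounded Om phi : test_function Om phi ->
  exists K, forall x, `|phi x| <= K.
Proof.
move=> tphi; have [_ [cphi _]] := tphi.
have : bounded_set (phi @` supp phi).
  apply: compact_bounded; apply: continuous_compact cphi.
  by apply: continuous_subspaceT; exact: test_continuous tphi.
move=> [M [_ hM]]; exists (`|M| + 1) => x.
have [p0|p0] := eqVneq (phi x) 0; first by rewrite p0 normr0 addr_ge0.
apply: (hM (`|M| + 1)); first by rewrite (le_lt_trans (ler_norm _))// ltrDl.
by exists x => //; exact: subset_closure.
Qed.

Lemma test_cube Om phi : test_function Om phi ->
  exists M, forall x, phi x != 0 -> cube M x.
Proof.
move=> [_ [/compact_bounded/bounded_set_coord[M _ hM] _]]; exists M => x px.
by apply: hM; exact: subset_closure.
Qed.

Lemma bounded_L2 Om g K : measurable Om -> (mu Om < +oo)%E ->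
  measurable_fun Om g -> (forall x, Om x -> `|g x| <= K) -> L2 Om g.
Proof.
move=> mOm fOm mg gK.
split => //; apply: measurable_bounded_integrable => //.
  exact: measurable_funX.
exists (K ^+ 2); split; first exact: num_real.
move=> M /ltW KM x Omx; apply: le_trans KM; rewrite normrX.
by rewrite lerXn2r ?nnegrE// ?gK// (le_trans _ (gK _ Omx)).
Qed.

Lemma test_L2 Om phi : measurable Om -> (mu Om < +oo)%E -> test_function Om phi ->
  L2 Om phi.
Proof.
move=> mOm fOm tphi; have [K hK] := test_bounded tphi.
apply: (@bounded_L2 _ _ K) => //.
by apply: measurable_funTS; exact: test_measurable tphi.
Qed.

End test_functions.

(** * Integration by parts *)

Section slices.
Context {R : realType} {d : nat}.

Local Notation e_ i := (delta_mx ord0 i).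

Lemma rV_cons_head (t h : R) (y : 'rV[R]_d) :
  h *: e_ ord0 + rV_cons (t, y) = rV_cons (h *: 1 + t, y).
Proof.
apply/rowP => i; rewrite /rV_cons !mxE /=; case: unliftP => [j ->|->].
  by rewrite mulr0 add0r.
by [].
Qed.

Lemma rV_cons_tail (t h : R) (y : 'rV[R]_d) j :
  h *: e_ (lift ord0 j) + rV_cons (t, y) = rV_cons (t, h *: e_ j + y).
Proof.
apply/rowP => i; rewrite /rV_cons !mxE /=; case: unliftP => [k ->|->].
  by rewrite (inj_eq lift_inj) !mxE.
by rewrite (negbTE (neq_lift _ _)) mulr0 add0r.
Qed.

Lemma continuous_rV_cons_tail (t : R) :
  continuous (fun y : 'rV[R]_d => rV_cons (t, y)).
Proof.
move=> y A /nbhs_ballP[e /= e0 eA]; apply/nbhs_ballP; exists e => // z [_ yz].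
apply: eA; split => // i j; rewrite /rV_cons !mxE /=.
by case: unliftP => [k _|_]; [exact: yz|exact: ballxx].
Qed.

Lemma continuous_rV_cons_head (y : 'rV[R]_d) :
  continuous (fun t : R => rV_cons (t, y)).
Proof.
move=> t A /nbhs_ballP[e /= e0 eA]; apply/nbhs_ballP; exists e => // s ts.
apply: eA; split => // i j; rewrite /rV_cons !mxE /=.
by case: unliftP => [k _|_]; [exact: ballxx|exact: ts].
Qed.

Variable eta : 'rV[R]_d.+1 -> R.

Lemma slice_tail_derive (t : R) (y : 'rV[R]_d) j :
  derivable eta (rV_cons (t, y)) (e_ (lift ord0 j)) ->
  derivable (fun y => eta (rV_cons (t, y))) y (e_ j) /\
  partial j (fun y => eta (rV_cons (t, y))) y =
  partial (lift ord0 j) eta (rV_cons (t, y)).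
Proof.
move=> deta.
have E : (fun h : R => h^-1 *: (((fun y => eta (rV_cons (t, y))) \o shift y)
     (h *: e_ j) - eta (rV_cons (t, y)))) =
  (fun h : R => h^-1 *: ((eta \o shift (rV_cons (t, y)))
     (h *: e_ (lift ord0 j)) - eta (rV_cons (t, y)))).
  by apply/funext => h /=; rewrite rV_cons_tail.
by split; [rewrite /derivable E|rewrite /partial /derive E].
Qed.

Lemma slice_head_derive (t : R) (y : 'rV[R]_d) :
  derivable eta (rV_cons (t, y)) (e_ ord0) ->
  is_derive t (1 : R) (fun t : R => eta (rV_cons (t, y)))
    (partial ord0 eta (rV_cons (t, y))).
Proof.
move=> deta.
have E : (fun h : R => h^-1 *: (((fun t => eta (rV_cons (t, y))) \o shift t)
     (h *: 1) - eta (rV_cons (t, y)))) =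
  (fun h : R => h^-1 *: ((eta \o shift (rV_cons (t, y)))
     (h *: e_ ord0) - eta (rV_cons (t, y)))).
  by apply/funext => h /=; rewrite rV_cons_head.
by split; [rewrite /derivable E|rewrite /partial /derive E].
Qed.

End slices.

Lemma bounded_supp_integrable (disp : measure_display) (T : measurableType disp)
    (R : realType) (mu : {measure set T -> \bar R}) (A : set T) (f : T -> R) (K : R) :
  measurable A -> (mu A < +oo)%E -> measurable_fun setT f ->
  (forall x, `|f x| <= K) -> (forall x, f x != 0 -> A x) ->
  mu.-integrable setT (EFin \o f).
Proof.
move=> mA fA mf fK f0.
have : mu.-integrable A (EFin \o f).
  apply: measurable_bounded_integrable => //; first exact: measurable_funTS.
  by exists K; split; [exact: num_real|move=> M /ltW KM x _; exact: le_trans KM].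
move/(integrable_mkcond _ mA).
apply: eq_integrable => // x _; rewrite patchE; case: ifPn => //.
rewrite notin_setE => nAx /=; congr EFin; apply/esym/eqP/negPn/negP.
by move=> /f0.
Qed.

Section integral_partial.
Context {R : realType}.

Lemma open_norm_gt (M : R) : open [set s : R | M < `|s|].
Proof.
apply: (@open_comp _ _ (@Num.norm _ R) [set s | M < s]) => [s _|].
  exact: norm_continuous.
exact: open_gt.
Qed.

(** The fundamental theorem of calculus on an interval that contains the
    support in its interior. *)
Lemma integral_derive_line (F F' : R -> R) (M : R) :
  (forall t : R, is_derive t (1 : R) F (F' t)) -> continuous F' ->
  (forall t, F t != 0 -> `|t| <= M) ->
  (\int[lebesgue_measure]_t (F' t)%:E = 0)%E.
Proof.
move=> dF cF' F0.
pose N := `|M| + 1.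
have N0 : 0 < N by rewrite ltr_wpDl.
have MN : M < N by rewrite (le_lt_trans (ler_norm _))// ltrDl.
have out t : M < `|t| -> F t = 0.
  by move=> Mt; apply/eqP/negPn/negP => /F0; rewrite leNgt Mt.
have F'0 t : M < `|t| -> F' t = 0.
  move=> Mt; have [_ <-] := dF t.
  rewrite -(near_eq_derive _ (f := cst 0)) ?derive_cst//.
  have : nbhs t [set s : R | M < `|s|].
    by apply: open_nbhs_nbhs; split => //; exact: open_norm_gt.
  by apply: filterS => s /= /out.
have -> : (\int[lebesgue_measure]_t (F' t)%:E =
    \int[lebesgue_measure]_(t in `[(- N)%R, N]) (F' t)%:E)%E.
  rewrite [RHS]integral_mkcond; apply: eq_integral => t _.
  rewrite patchE; case: ifPn => //; rewrite notin_setE /= in_itv/= -ler_norml.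
  by move=> /negP; rewrite -ltNge => Nt; rewrite F'0// (lt_trans MN).
have cF : continuous F.
  move=> t; apply/differentiable_continuous/derivable1_diffP.
  by have [] := dF t.
rewrite (@continuous_FTC2 _ F' F).
- by rewrite !out ?subee// ?normrN gtr0_norm.
- by rewrite gt0_cp.
- exact: continuous_subspaceT.
- split=> [t _||].
  + by have [] := dF t.
  + by apply: cvg_at_right_filter; exact: cF.
  + by apply: cvg_at_left_filter; exact: cF.
- by move=> t _; rewrite derive1E; have [_ ->] := dF t.
Qed.

(** The measure of R^(d+1) is built by adding one coordinate in front: for the
    first coordinate Fubini leaves a one-dimensional integral inside, for the
    other ones the statement in dimension [d] for the slices. Hence the weak
    hypotheses, which are inherited by slices; boundedness of the derivative on
    the cube is all the integrability that Fubini needs. *)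
Lemma integral_partial (d : nat) (j : 'I_d) (eta : 'rV[R]_d -> R) (M K : R) :
  (forall x, derivable eta x (delta_mx ord0 j)) -> continuous (partial j eta) ->
  (forall x, `|partial j eta x| <= K) -> (forall x, eta x != 0 -> cube M x) ->
  (\int[lebesgue_rV d]_x (partial j eta x)%:E = 0)%E.
Proof.
elim: d j eta => [|d ih] j eta; first by case: j.
move=> deta ceta etaK etaM.
have pM x : partial j eta x != 0 -> cube M x.
  move=> px i; rewrite leNgt; apply/negP => Mx.
  move/eqP: px; apply; rewrite /partial.
  rewrite -(near_eq_derive _ (f := cst 0)) ?derive_cst//.
  have : nbhs (x ord0 i) [set s : R | M < `|s|].
    by apply: open_nbhs_nbhs; split => //; exact: open_norm_gt.
  move=> nM; have nx : nbhs x [set y : 'rV[R]_d.+1 | M < `|y ord0 i|].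
    exact: (@coord_continuous R 1 d.+1 ord0 i x _ nM).
  apply: (@filterS _ (nbhs x) _ _ _ _ nx) => y /= My.
  apply/esym/eqP/negPn/negP => /etaM/(_ i).
  by rewrite leNgt My.
have mp : measurable_fun setT (partial j eta) by exact: continuous_rV_measurable.
pose f (p : R * 'rV[R]_d) := partial j eta (rV_cons p).
have mcons := @measurable_rV_cons R d.
have mf : measurable_fun setT f by exact: measurableT_comp.
have fi : (lebesgue_measure \x lebesgue_rV d)%E.-integrable setT (EFin \o f).
  apply: (@bounded_supp_integrable _ _ R (lebesgue_measure \x lebesgue_rV d)%E
    (@rV_cons R d @^-1` cube M) f K) => //.
  - rewrite -[X in measurable X]setTI; apply: mcons => //; exact: measurable_cube.
  - exact: (@cube_measure_fin R d.+1 M).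
  - by move=> p; exact: etaK.
  - by move=> p pp; exact: (pM _ pp).
rewrite /= /rV_cons_measure integral_pushforward//; last exact/measurable_EFinP.
rewrite preimage_setT.
have [j' Ej|Ej] := unliftP ord0 j; subst j.
  rewrite -(integral12_prod_meas1 fi) (eq_integral (cst 0%E)) ?integral0//.
  move=> t _; rewrite /fubini_F /f /=.
  have slice y := slice_tail_derive (deta (rV_cons (t, y))).
  have pE : partial j' (fun y => eta (rV_cons (t, y))) =
      fun y => partial (lift ord0 j') eta (rV_cons (t, y)).
    by apply/funext => y; exact: (slice y).2.
  transitivity (\int[lebesgue_rV d]_y
      (partial j' (fun y => eta (rV_cons (t, y))) y)%:E)%E.
    by apply: eq_integral => y _; rewrite pE.
  apply: ih.
  - by move=> y; exact: (slice y).1.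
  - rewrite pE => y.
    apply: (@continuous_comp _ _ _ (fun y => rV_cons (t, y))
      (partial (lift ord0 j') eta)); last exact: ceta.
    exact: continuous_rV_cons_tail.
  - by move=> y; rewrite pE; exact: etaK.
  - move=> y /etaM yM i; have := yM (lift ord0 i).
    by rewrite /rV_cons mxE liftK.
rewrite -(integral21_prod_meas1 fi) (eq_integral (cst 0%E)) ?integral0//.
move=> y _; rewrite /fubini_G /f /=.
apply: (@integral_derive_line (fun t => eta (rV_cons (t, y))) _ M).
- by move=> t; apply: slice_head_derive; exact: deta.
- move=> t; apply: (@continuous_comp _ _ _ (fun t => rV_cons (t, y)) (partial ord0 eta)).
    exact: continuous_rV_cons_head.
  exact: ceta.
- by move=> t /etaM/(_ ord0); rewrite /rV_cons mxE unlift_none.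
Qed.

End integral_partial.

(** * Bump functions *)

Section flat.
Context {R : realType}.

(** The derivatives of [exp (- 1 / x)] extended by zero are combinations of
    these functions, which is why the powers of [1 / x] are included. *)
Definition flat (k : nat) (x : R) : R :=
  if 0 < x then x^-1 ^+ k * expR (- x^-1) else 0.

(** The exponential series dominates its term of order [k.+1]. The bound is
    linear in [x], hence flat at the origin for every [k]. *)
Lemma flat_bound k x : `|flat k x| <= k.+1`!%:R * `|x|.
Proof.
rewrite /flat; case: ifPn => [x0|_]; last by rewrite normr0 mulr_ge0.
rewrite !gtr0_norm// ?mulr_gt0 ?exprn_gt0 ?invr_gt0 ?expR_gt0//.
have y0 : 0 < x^-1 by rewrite invr_gt0.
have := @expR_ge1Dxn R x^-1 k (ltW y0).
rewrite expRN ler_pdivrMr ?expR_gt0// => h.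
have {}h : x^-1 ^+ k.+1 / k.+1`!%:R <= expR x^-1.
  by apply: le_trans h; rewrite lerDr.
have f0 : (0 : R) < k.+1`!%:R by rewrite ltr0n fact_gt0.
rewrite ler_pdivrMr// in h.
rewrite -(ler_pM2l y0) -exprS (le_trans h)//.
rewrite [leRHS](_ : _ = expR x^-1 * k.+1`!%:R)//.
by field; rewrite gt_eqF.
Qed.

Lemma flat0 k x : x <= 0 -> flat k x = 0.
Proof. by rewrite /flat ltNge => ->. Qed.

Lemma flat_quotient k (h : R) : h^-1 * flat k h = flat k.+1 h.
Proof. by rewrite /flat; case: ifP => _; rewrite ?mulr0// mulrA -exprS. Qed.

Lemma flat_cvg0 k : flat k x @[x --> (0 : R)] --> (0 : R).
Proof.
apply/norm_cvg0P; apply: (@squeeze_cvgr _ _ _ _ (fun=> 0)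
  (fun x => k.+1`!%:R * `|x|)).
- by apply: nearW => x; rewrite normr_ge0 flat_bound.
- exact: cvg_cst.
- have h : `|x| @[x --> (0 : R)] --> `|0 : R| by exact: norm_continuous.
  rewrite normr0 in h.
  rewrite [X in _ --> X](_ : 0 = k.+1`!%:R * 0); last by rewrite mulr0.
  by apply: cvgMr.
Qed.

(** At the origin the difference quotient of [flat k] is [flat k.+1] itself,
    which tends to zero. *)
Lemma flat_derive k (x : R) :
  is_derive x (1 : R) (flat k) (flat k.+2 x - k%:R * flat k.+1 x).
Proof.
have [x0|x0|->] := ltgtP x 0.
- rewrite !flat0 ?ltW// mulr0 subr0.
  have near0 : \near x, cst 0 x = flat k x.
    have : \near x, x < 0 by exact: lt_nbhsl.
    by apply: filterS => z z0; rewrite flat0// ltW.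
  exact: near_eq_is_derive near0 _.
- have nearp : \near x, (x^-1) ^+ k * expR (- x^-1) = flat k x.
    have : \near x, 0 < x by exact: lt_nbhsr.
    by apply: filterS => z z0; rewrite /flat z0.
  apply: near_eq_is_derive nearp _.
  have d1 : is_derive x (1 : R) (fun z : R => z^-1) (- x ^- 2 *: 1).
    by apply: is_deriveV; rewrite gt_eqF.
  have d2 : is_derive x (1 : R) ((fun z : R => z^-1) ^+ k)
     ((k%:R * x^-1 ^+ k.-1) *: (- x ^- 2 *: 1)) by exact: is_deriveX.
  have d3 : is_derive x (1 : R) (fun z : R => expR (- z^-1))
     (expR (- x^-1) * (- (- x ^- 2 *: 1))).
    exact: (@is_derive1_comp _ expR (fun z : R => - z^-1)).
  have d4 := is_deriveM d2 d3.
  have -> : (fun z : R => z^-1 ^+ k * expR (- z^-1)) =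
      ((fun z : R => z^-1) ^+ k * (fun z : R => expR (- z^-1))).
    by rewrite exprfctE.
  apply: is_derive_eq d4 _.
  rewrite /flat x0 exprfctE /GRing.scale/= !mulr1.
  case: k {d2} => [|k] /=.
    by rewrite !mul0r subr0 expr0 !mulr0 addr0 mul1r opprK mulrC exprVn.
  by rewrite !exprS !exprVn; field; rewrite expf_neq0 gt_eqF.
- have E : (fun h : R => h^-1 *: ((flat k \o shift 0) (h *: (1 : R)) - flat k 0)) =
      flat k.+1.
    apply/funext => h /=; rewrite addr0 [h *: (1 : R)]mulr1 (flat0 k (lexx 0)) subr0.
    exact: flat_quotient.
  rewrite !flat0// mulr0 subr0.
  have c0 : flat k.+1 x @[x --> 0^'] --> (0 : R).
    apply: cvg_trans (flat_cvg0 k.+1); apply: cvg_app; exact: cvg_within.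
  split; last by rewrite /derive E; exact: cvg_lim.
  by rewrite /derivable E; apply/cvg_ex; exists 0.
Qed.

Lemma flat_continuous k : continuous (flat k).
Proof.
move=> x; apply/differentiable_continuous/derivable1_diffP.
by have [] := flat_derive k x.
Qed.

Lemma flat_ge0 k x : 0 <= flat k x.
Proof.
rewrite /flat; case: ifP => // x0.
by rewrite mulr_ge0 ?expR_ge0// exprn_ge0// invr_ge0 ltW.
Qed.

Lemma flat_le1 x : flat 0 x <= 1.
Proof.
rewrite /flat; case: ifP => // x0.
by rewrite expr0 mul1r expR_le1 oppr_le0 invr_ge0 ltW.
Qed.

Lemma flat_gt0 x : (0 < flat 0 x) = (0 < x).
Proof. by rewrite /flat; case: ifP; rewrite ?ltxx// expr0 mul1r expR_gt0. Qed.

(** Dilating [flat 0] turns it into the indicator of the positive half-line. *)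
Lemma flat_dilate (x : R) :
  flat 0 (n%:R * x) @[n --> \oo] --> ((0 < x)%R%:R : R).
Proof.
have [x0|x0] := ltrP 0 x; last first.
  rewrite (_ : (fun n => _) = fun=> 0); first exact: cvg_cst.
  by apply/funext => n; rewrite flat0// mulr_ge0_le0.
rewrite -cvg_shiftS /=.
rewrite (_ : (fun n => _) = fun n => expR (- (x^-1 * n.+1%:R^-1))); last first.
  apply/funext => n; rewrite /flat mulr_gt0 ?ltr0n// expr0 mul1r invfM.
  by rewrite (mulrC x^-1).
have h : - (x^-1 * n.+1%:R^-1) @[n --> \oo] --> (0 : R).
  rewrite [X in _ --> X](_ : 0 = - (x^-1 * 0)); last by rewrite mulr0 oppr0.
  by apply: cvgN; apply: cvgMr; exact: cvg_harmonic.
by have := cvg_comp _ _ h (@continuous_expR R 0); rewrite expR0.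
Qed.

End flat.

Section bumps.
Context {R : realType} {d : nat}.
Implicit Types (Om : set 'rV[R]_d) (g : 'rV[R]_d -> R).
Local Notation mu := (@lebesgue_rV R d).
Local Notation e_ i := (delta_mx ord0 i : 'rV[R]_d).

Definition ridge (k : nat) (s t : R) (i : 'I_d) (x : 'rV[R]_d) : R :=
  flat k (s * x ord0 i + t).

Lemma is_derive_coord (F : R -> R) (F' s t : R) i (x : 'rV[R]_d) j :
  is_derive (s * x ord0 i + t) (1 : R) F F' ->
  is_derive x (e_ j) (fun y : 'rV[R]_d => F (s * y ord0 i + t))
    ((i == j)%:R * s * F').
Proof.
move=> dF; pose a := (i == j)%:R * s.
pose G (h : R) := F (a * h + (s * x ord0 i + t)).
have E : (fun h : R => h^-1 *: (((fun y : 'rV[R]_d => F (s * y ord0 i + t)) \o shift x)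
      (h *: e_ j) - F (s * x ord0 i + t))) =
    (fun h : R => h^-1 *: ((G \o shift 0) (h *: (1 : R)) - G 0)).
  apply/funext => h /=; rewrite /G addr0 mulr0 add0r !mxE eqxx /=.
  rewrite [h *: (1 : R)]mulr1; congr (_ *: (F _ - _)).
  by rewrite /a; ring.
have dG : is_derive (0 : R) (1 : R) G (F' * a).
  apply: (@is_derive1_comp _ F (fun h => a * h + (s * x ord0 i + t))).
    by rewrite mulr0 add0r.
  have -> : (fun h => a * h + (s * x ord0 i + t)) =
      (a \*: (id : R -> R)) + cst (s * x ord0 i + t) by [].
  by apply: is_derive_eq; rewrite addr0 [_ *: _]mulr1.
split; first by rewrite /derivable E; have [] := dG.
have [_ dG1] := dG; rewrite /derive E.
by move: dG1; rewrite /derive => ->; rewrite mulrC.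
Qed.

Lemma ridge_derive k s t i (x : 'rV[R]_d) j :
  is_derive x (e_ j) (ridge k s t i)
   ((i == j)%:R * s * (ridge k.+2 s t i x + - k%:R * ridge k.+1 s t i x)).
Proof.
by apply: is_derive_coord; rewrite /ridge mulNr; exact: flat_derive.
Qed.

Lemma partial_coord i j (x : 'rV[R]_d) :
  is_derive x (e_ j) (fun y : 'rV[R]_d => y ord0 i) (i == j)%:R.
Proof.
have := @is_derive_coord id 1 1 0 i x j (is_derive_id _ _).
rewrite !mulr1; congr is_derive; apply/funext => y.
by rewrite /= mul1r addr0.
Qed.

Lemma coord_smooth i : smooth_on setT (fun y : 'rV[R]_d => y ord0 i).
Proof.
pose S := [set fun y : 'rV[R]_d => y ord0 i].
apply: (@smooth_on_generated _ _ S); first exact: openT.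
- move=> _ -> x _; split; first exact: coord_continuous.
  by move=> j; have [] := partial_coord i j x.
- move=> _ -> j; exists (cst (i == j)%:R); first exact: alg_cst.
  by move=> x _; have [_ E] := partial_coord i j x; exact: E.
- exact: alg_base.
Qed.

Lemma ridge_continuous k s t i : continuous (ridge k s t i).
Proof.
move=> x.
apply: (@continuous_comp _ _ _ (fun x : 'rV[R]_d => x ord0 i)
  (fun r => flat k (s * r + t))); first exact: coord_continuous.
apply: (@continuous_comp _ _ _ (fun r : R => s * r + t) (flat k)).
  by apply: cvgD; [apply: cvgMr; exact: cvg_id|exact: cvg_cst].
exact: flat_continuous.
Qed.

(** The ridges of all orders [k] generate an algebra that is closed under
    differentiation. *)
Lemma ridge_smooth k s t i : smooth_on setT (ridge k s t i).
Proof.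
pose S := [set g | exists k s t i, g = ridge k s t i].
apply: (@smooth_on_generated _ _ S); first exact: openT.
- move=> _ [k' [s' [t' [i' ->]]]] x _; split; first exact: ridge_continuous.
  by move=> j; have [] := ridge_derive k' s' t' i' x j.
- move=> _ [k' [s' [t' [i' ->]]]] j.
  exists (cst ((i' == j)%:R * s') *
      (ridge k'.+2 s' t' i' + cst (- k'%:R) * ridge k'.+1 s' t' i')).
    apply: alg_mul; first exact: alg_cst.
    apply: alg_add; first by apply: alg_base; exists k'.+2, s', t', i'.
    apply: alg_mul; first exact: alg_cst.
    by apply: alg_base; exists k'.+1, s', t', i'.
  by move=> x _; have [_ E] := ridge_derive k' s' t' i' x j; exact: E.
- by apply: alg_base; exists k, s, t, i.
Qed.

Definition box_bump (p q : 'I_d -> R) (x : 'rV[R]_d) : R :=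
  \prod_(i < d) (ridge 0 1 (- p i) i x * ridge 0 (- 1) (q i) i x).

Definition orthant_cutoff (n : nat) (a : 'I_d -> R) (x : 'rV[R]_d) : R :=
  \prod_(i < d) ridge 0 (- n%:R) (n%:R * a i) i x.

Lemma closed_box_compact (p q : 'I_d -> R) : compact (closed_box p q).
Proof.
have := @rV_compact R d (fun i => [set` `[p i, q i]]).
by apply => i; exact: segment_compact.
Qed.

Lemma box_bump_gt0 (p q : 'I_d -> R) x : open_box p q x -> 0 < box_bump p q x.
Proof.
move=> pxq; apply: prodr_gt0 => i _; have /andP[pi qi] := pxq i.
rewrite mulr_gt0// /ridge flat_gt0; first by rewrite mul1r subr_gt0.
by rewrite mulN1r addrC subr_gt0.
Qed.

Lemma box_bump_smooth p q : smooth_on setT (box_bump p q).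
Proof.
apply: smooth_on_prod; first exact: openT.
by move=> i; apply: smooth_onM; [exact: openT|exact: ridge_smooth|exact: ridge_smooth].
Qed.

Lemma orthant_cutoff_smooth n a : smooth_on setT (orthant_cutoff n a).
Proof.
by apply: smooth_on_prod; [exact: openT|move=> i; exact: ridge_smooth].
Qed.

Lemma box_bump_test Om p q : closed_box p q `<=` Om ->
  test_function Om (box_bump p q).
Proof.
move=> pqOm; split; first exact: box_bump_smooth.
have sub : closure [set x | box_bump p q x != 0] `<=` closed_box p q.
  apply: closure_min.
    by apply: compact_closed; [exact: norm_hausdorff|exact: closed_box_compact].
  move=> x /= /prodf_neq0 nx i; have := nx i isT.
  rewrite mulf_eq0 negb_or /ridge => /andP[n1 n2]; apply/andP; split.
    rewrite leNgt; apply: contra n1 => xp.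
    by rewrite flat0// mul1r subr_le0 ltW.
  rewrite leNgt; apply: contra n2 => xp.
  by rewrite flat0// mulN1r addrC subr_le0 ltW.
split; last exact: subset_trans pqOm.
apply: subclosed_compact sub; first exact: closed_closure.
exact: closed_box_compact.
Qed.

Definition orthant (a : 'I_d -> R) : set 'rV[R]_d :=
  [set x | forall i, x ord0 i < a i].

Lemma measurable_orthant a : measurable (orthant a).
Proof.
have := @measurable_coord_preimage R d (fun i => [set` `]-oo, a i[]).
rewrite (_ : [set x | _] = orthant a) ?in_itv//.
by apply => i; exact: measurable_itv.
Qed.

Lemma orthant_cutoff_le1 n a x : `|orthant_cutoff n a x| <= 1.
Proof.
rewrite ger0_norm; last by apply: prodr_ge0 => i _; exact: flat_ge0.
by apply: prodr_ile1 => i _; rewrite flat_ge0 flat_le1.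
Qed.

Lemma orthant_cutoff_cvg a x :
  orthant_cutoff n a x @[n --> \oo] --> (\1_(orthant a) x : R).
Proof.
have h (r : seq 'I_d) :
    \prod_(i <- r) ridge 0 (- n%:R) (n%:R * a i) i x @[n --> \oo] -->
    \prod_(i <- r) ((0 < a i - x ord0 i)%R%:R : R).
  elim: r => [|i r ih].
    under eq_fun do rewrite big_nil.
    by rewrite big_nil; exact: cvg_cst.
  under eq_fun do rewrite big_cons.
  rewrite big_cons; apply: cvgM ih.
  under eq_fun do rewrite /ridge mulNr addrC -mulrBr.
  exact: flat_dilate.
rewrite (_ : \1__ _ = \prod_(i < d) ((0 < a i - x ord0 i)%R%:R : R)); first exact: h.
rewrite indicE; case: (pselect (orthant a x)) => [ax|nax].
  rewrite mem_set// big1// => i _.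
  by rewrite subr_gt0 (ax i).
rewrite memNset//; have /existsNP[i /negP nai] := nax.
by rewrite (bigD1 i)//= subr_gt0 (negbTE nai) mul0r.
Qed.

Lemma orthant_setI : setI_closed [set orthant a | a in setT].
Proof.
move=> _ _ [a _ <-] [b _ <-]; exists (fun i => Num.min (a i) (b i)) => //.
apply/seteqP; split => x /=.
  by move=> h; split => i; have := h i; rewrite lt_min => /andP[].
by move=> [xa xb] i; rewrite lt_min xa xb.
Qed.

(** A half-space bounded in one coordinate is the union of the orthants whose
    other corners go to infinity. *)
Lemma measurable_rV_orthant :
  (@measurable _ 'rV[R]_d) = <<s [set orthant a | a in setT] >>.
Proof.
apply/seteqP; split; last first.
  apply: smallest_sub; first exact: sigma_algebra_measurable.
  by move=> _ [a _ <-]; exact: measurable_orthant.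
pose SO := <<s [set orthant a | a in setT] >>.
have saO : sigma_algebra setT SO by exact: smallest_sigma_algebra.
apply: smallest_sub => // A; rewrite -bigcup_seq => -[i _ [B mB <-]].
rewrite setTI /=.
have : <<s (@RGenInftyO.G R) >> B.
  by move: mB; rewrite [X in X _ -> _](RGenInftyO.measurableE R).
pose C := [set B : set R | SO ((fun x : 'rV[R]_d => x ord0 i) @^-1` B)].
suff : <<s (@RGenInftyO.G R) >> `<=` C by apply.
apply: smallest_sub.
  have [S0 SC SU] := saO; split; rewrite /C /=.
  - by rewrite preimage_set0.
  - by move=> D SD; rewrite setTD preimage_setC -setTD; exact: SC.
  - by move=> F SF; rewrite preimage_bigcup; exact: SU.
move=> _ [b ->]; rewrite /C /=.
rewrite (_ : _ @^-1` _ =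
    \bigcup_n orthant (fun j => if j == i then b else n%:R)).
  by have [_ _] := saO; apply => n; apply: sub_sigma_algebra; eexists.
apply/seteqP; split => x /=; rewrite in_itv/=.
  move=> xb; exists (Num.truncn `|x|).+1 => // j; case: eqVneq => [->//|_].
  apply: le_lt_trans (ler_norm _) _; apply: le_lt_trans (rV_coord_le_norm _ _) _.
  exact: truncnS_gt.
by move=> [n _ /(_ i)]; rewrite eqxx.
Qed.

End bumps.

(** * The fundamental lemma of the calculus of variations *)

Section fundamental_lemma.
Context {R : realType} {d : nat} (Om : set 'rV[R]_d).
Hypotheses (oOm : open Om) (bOm : bounded_set Om).
Local Notation mu := (@lebesgue_rV R d).

Let mOm : measurable Om := open_rV_measurable oOm.
Let fOm : (mu Om < +oo)%E := bounded_measure_fin mOm bOm.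

Variable g : 'rV[R]_d -> R.
Hypothesis Lg : L2 Om g.
Hypothesis g0 : forall phi, test_function Om phi -> ip Om g phi = 0.

(** The functions [orthant_cutoff n a * chi] are test functions, at most [chi]
    in absolute value, and tend to the restriction of [chi] to the orthant. *)
Lemma orthant_integral0 chi a : test_function Om chi ->
  (\int[mu]_(x in Om) (g x * chi x * \1_(orthant a) x)%:E = 0)%E.
Proof.
move=> tchi; have Lchi := test_L2 mOm fOm tchi.
have ichi := L2_integrableM mOm Lg Lchi.
have mg := L2_measurable Lg; have mchi := L2_measurable Lchi.
have tn n : test_function Om (orthant_cutoff n a * chi).
  apply: test_mul => //; apply: smooth_on_subset (orthant_cutoff_smooth n a).
  exact: subsetT.
have [|||||_ _ cv] := @dominated_convergence _ _ R mu Om mOm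
  (fun n x => (g x * (orthant_cutoff n a * chi) x)%:E)
  (fun x => (g x * chi x * \1_(orthant a) x)%:E)
  (fun x => `|(g x * chi x)%:E|%E).
- move=> n; apply/measurable_EFinP; apply: measurable_funM => //.
  exact: L2_measurable (test_L2 mOm fOm (tn n)).
- apply/measurable_EFinP; apply: measurable_funM; first exact: measurable_funM.
  by apply: measurable_indic; exact: measurable_orthant.
- apply: aeW => x _; apply: cvg_EFin; first exact: nearW.
  rewrite (_ : _ \o _ = fun n => g x * chi x * orthant_cutoff n a x).
    by apply: cvgMr; exact: orthant_cutoff_cvg.
  by apply/funext => n /=; rewrite mulrAC -mulrA.
- exact: integrable_abse.
- apply: aeW => x n _ /=; rewrite lee_fin.
  rewrite (_ : g x * _ = orthant_cutoff n a x * (g x * chi x)); last first.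
    by rewrite mulrCA.
  by rewrite normrM ler_piMl// orthant_cutoff_le1.
apply/esym; apply: cvg_unique cv => //.
rewrite (_ : (fun n => _) = cst 0%E); first exact: cvg_cst.
apply/funext => n; have := g0 (tn n); rewrite /ip /Rintegral.
set I := (\int[mu]_(x in Om) _)%E => I0.
have : I \is a fin_num.
  by apply: integrable_fin_num => //; exact: L2_integrableM (test_L2 mOm fOm (tn n)).
by move/fineK => <-; rewrite I0.
Qed.

(** The sets on which [g * chi] has integral zero form a Dynkin class, and the
    orthants are an intersection-stable generator contained in it. *)
Lemma test_mul_ae0 chi : test_function Om chi ->
  \forall x \ae mu, Om x -> g x * chi x = 0.
Proof.
move=> tchi; have Lchi := test_L2 mOm fOm tchi.
have ichi := L2_integrableM mOm Lg Lchi.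
pose h := (fun x => g x * chi x) \_ Om.
have hE : EFin \o h = (EFin \o (fun x => g x * chi x)) \_ Om.
  by rewrite restrict_EFin.
have ih : mu.-integrable setT (EFin \o h).
  by rewrite hE; exact/(integrable_mkcond _ mOm).
have ihA A : measurable A -> mu.-integrable A (EFin \o h).
  by move=> mA; exact: integrableS ih.
have hT : (\int[mu]_x (h x)%:E = 0)%E.
  rewrite -[LHS]/(\int[mu]_x (EFin \o h) x)%E hE -integral_mkcond.
  rewrite -[LHS]fineK; last exact: integrable_fin_num.
  by have := g0 tchi; rewrite /ip /Rintegral => ->.
have hA A : measurable A -> (\int[mu]_(x in A) (h x)%:E = 0)%E.
  move=> mA; apply: (@dynkin_induction _ _ [set orthant a | a in setT]
    (fun A => (\int[mu]_(x in A) (h x)%:E = 0)%E)) => //.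
  - exact: measurable_rV_orthant.
  - exact: orthant_setI.
  - move=> _ [a _ <-]; rewrite -[RHS](orthant_integral0 a tchi).
    rewrite -[LHS]/(\int[mu]_(x in orthant a) (EFin \o h) x)%E hE.
    rewrite -integral_mkcondr setIC integral_mkcondr.
    apply: eq_integral => x _; rewrite patchE indicE /=.
    by case: ifPn => _; rewrite ?mulr1 ?mulr0.
  - move=> S mS S0; have mSC := measurableC mS.
    have := hT; rewrite -(setUv S) integral_setU_EFin//.
    + by rewrite S0 add0e.
    + by rewrite setUv; apply/measurable_EFinP; exact: measurable_int ih.
    + by apply/disj_setPS; rewrite setICr.
  - move=> F mF tF F0; rewrite integral_bigcup//; last first.
      by apply: ihA; exact: bigcupT_measurable.
    by rewrite eseries0// => n _ _; exact: F0.
  - by rewrite -measurable_rV_orthant.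
have : ae_eq mu setT (EFin \o h) (cst 0%E).
  apply: integral_ae_eq => // E _ mE; rewrite integral0.
  exact: hA.
apply: filterS => x /(_ I) + Omx; rewrite /h /= patchE mem_set//.
by case.
Qed.

(** Countably many bumps, one for each rational box in [Om], have no common
    zero in [Om]. *)
Lemma fundamental_lemma : ae_eq mu Om g (cst 0).
Proof.
pose bump (n : nat) : 'rV[R]_d -> R :=
  if unpickle n is Some pq then
    let p := ratr \o (pq : {ffun 'I_d -> rat} * {ffun 'I_d -> rat}).1 : 'I_d -> R in
    let q := ratr \o pq.2 : 'I_d -> R in
    if `[< closed_box p q `<=` Om >] then box_bump p q else cst 0
  else cst 0.
have tbump n : test_function Om (bump n).
  have t0 : test_function Om (cst 0).
    split; first exact: smooth_on_cst openT.
    rewrite (_ : [set x | _] = set0).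
      by rewrite closure0; split; [exact: compact0|exact: sub0set].
    by apply/seteqP; split => // x /=; rewrite eqxx.
  rewrite /bump; case: (unpickle n) => [pq|//] /=.
  by case: asboolP => // pqOm; exact: box_bump_test.
have : \forall x \ae mu, forall n, Om x -> g x * bump n x = 0.
  by apply: ae_foralln => n; exact: test_mul_ae0.
apply: filterS => x gx Omx.
have [pq [xpq pqOm]] := open_box_nbhs oOm Omx.
have := gx (pickle pq) Omx; rewrite /bump pickleK /= asboolT// => /eqP.
by rewrite mulf_eq0 (gt_eqF (box_bump_gt0 xpq)) orbF => /eqP.
Qed.

End fundamental_lemma.

(** * Multi-indices *)

Lemma seq2_counts (T : eqType) (i j : T) (s : seq T) : size s = 2%N ->
  count_mem i s = (1 + (i == j))%N -> count_mem j s = ((j == i) + 1)%N ->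
  s = [:: i; j] \/ s = [:: j; i].
Proof.
case: s => [//|k [//|l [|//]]] _ /=; rewrite !addn0 (eq_sym j i).
have [->|ki] := eqVneq k i; have [->|li] := eqVneq l i => //.
- by have [->|] := eqVneq i j; [left|].
- have [//|ij] := eqVneq i j.
  by have [->|lj] := eqVneq l j; [left|].
- have [//|ij] := eqVneq i j.
  by have [->|kj] := eqVneq k j; [right|].
Qed.

Section multi_indices.
Context {R : realType} {d : nat}.
Implicit Types (al : 'I_d -> nat) (g phi : 'rV[R]_d -> R).

Definition index_seq al : seq 'I_d := flatten [seq nseq (al i) i | i <- enum 'I_d].

(** Spelling a multi-index as a word of coordinates turns mixed derivatives
    into the iterated derivatives that define smoothness. *)
Lemma mderivE al g : mderiv al g = foldr partial g (index_seq al).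
Proof.
rewrite /mderiv /index_seq; elim: (enum 'I_d) => [//|i s ih] /=.
rewrite foldr_cat -ih; elim: (al i) => [//|n ihn] /=.
by rewrite ihn.
Qed.

Lemma count_index_seq al i : count_mem i (index_seq al) = al i.
Proof.
rewrite /index_seq count_flatten -!map_comp.
rewrite (@eq_map _ _ _ (fun j => (j == i) * al j)%N); last first.
  by move=> j /=; rewrite count_nseq.
rewrite sumnE big_map -enumT big_enum /= (bigD1 i)//= eqxx mul1n big1 ?addn0//.
by move=> j /negbTE ->.
Qed.

Lemma size_index_seq al : size (index_seq al) = mlength al.
Proof.
rewrite /index_seq size_flatten /shape -!map_comp sumnE big_map -enumT big_enum /=.
by apply: eq_bigr => i _; rewrite /= size_nseq.
Qed.

Lemma mderiv0 al g : mlength al = 0%N -> mderiv al g = g.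
Proof. by rewrite mderivE -size_index_seq => /size0nil ->. Qed.

Definition unit_index (i : 'I_d) : 'I_d -> nat := fun j => (j == i) : nat.

Lemma mlength_unit i : mlength (unit_index i) = 1%N.
Proof.
rewrite /mlength (bigD1 i)//= /unit_index eqxx big1// => j /negbTE ->.
by [].
Qed.

Lemma mderiv_unit i g : mderiv (unit_index i) g = partial i g.
Proof.
rewrite mderivE; have := size_index_seq (unit_index i).
have := count_index_seq (unit_index i) i; rewrite mlength_unit /unit_index eqxx.
case: index_seq => [//|j [|//]] /=; rewrite addn0.
by case: eqVneq => [-> //|_ []].
Qed.

Lemma mlength_le1 al : (mlength al <= 1)%N ->
  mlength al = 0%N \/ exists i, al = unit_index i.
Proof.
rewrite leq_eqVlt ltnS leqn0 => /orP[/eqP al1|/eqP al0]; last by left.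
right; have := size_index_seq al; rewrite al1.
case E : (index_seq al) => [//|i [|//]] _; exists i; apply/funext => j.
by rewrite -(count_index_seq al j) E /= addn0 /unit_index eq_sym.
Qed.

Definition pair_index (i j : 'I_d) : 'I_d -> nat :=
  fun k => ((k == i) + (k == j))%N.

Lemma mlength_pair i j : mlength (pair_index i j) = 2%N.
Proof. by rewrite /mlength big_split /= -[X in (X + _)%N]/(mlength (unit_index i))
  -[X in (_ + X)%N]/(mlength (unit_index j)) !mlength_unit. Qed.

Lemma mderiv_pair i j g : smooth_on setT g ->
  mderiv (pair_index i j) g = partial i (partial j g).
Proof.
move=> sg; rewrite mderivE; have := size_index_seq (pair_index i j).
have := count_index_seq (pair_index i j) j.
have := count_index_seq (pair_index i j) i.
rewrite mlength_pair /pair_index !eqxx => ci cj sz.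
have [->|->] := seq2_counts sz ci cj; first by [].
exact: partialC.
Qed.

Lemma mlength_ge al i : (al i <= mlength al)%N.
Proof. by rewrite /mlength (bigD1 i)//= leq_addr. Qed.

End multi_indices.

(** * Weak derivatives *)

Section weak_derivatives.
Context {R : realType} {d : nat} (Om : set 'rV[R]_d).
Hypotheses (oOm : open Om) (bOm : bounded_set Om).
Local Notation mu := (@lebesgue_rV R d).
Implicit Types (al : 'I_d -> nat) (a u v g h phi psi : 'rV[R]_d -> R).

Let mOm : measurable Om := open_rV_measurable oOm.
Let fOm : (mu Om < +oo)%E := bounded_measure_fin mOm bOm.
Let tL2 phi := @test_L2 R d Om phi mOm fOm.

Lemma test_mderiv al phi : test_function Om phi -> test_function Om (mderiv al phi).
Proof. by move=> tphi; rewrite mderivE; exact: test_foldr. Qed.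

Lemma wderiv_L2 al u : L2 Om (wderiv Om al u).
Proof.
rewrite /wderiv; case: xgetP => [g _ []//|_].
exact: L2_cst0.
Qed.

Lemma wderiv_weak al u g : L2 Om g -> weak_derivative Om al u g ->
  weak_derivative Om al u (wderiv Om al u).
Proof.
move=> Lg wg; rewrite /wderiv; case: xgetP => [h _ []//|].
by move=> /(_ g); rewrite /= => /not_andP[].
Qed.

(** The difference of two weak derivatives is orthogonal to all test
    functions. *)
Lemma weak_unique al u g h : L2 Om g -> L2 Om h ->
  weak_derivative Om al u g -> weak_derivative Om al u h -> ae_eq mu Om g h.
Proof.
move=> Lg Lh wg wh.
have : ae_eq mu Om (g \- h) (cst 0).
  apply: fundamental_lemma => //; first exact: L2B.
  move=> phi tphi; rewrite ipB//; last exact: tL2.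
  have := wg phi tphi; rewrite (wh phi tphi).
  by move/(mulfI (negbT (signr_eq0 _ _))) => E; rewrite /ip E subrr.
by apply: filterS => x gh Omx; apply/eqP; rewrite -subr_eq0; apply/eqP; exact: gh.
Qed.

(** The chosen representative is pinned down by the defining identity, which is
    how all the following properties of [wderiv] are obtained. *)
Lemma wderiv_ae al u g : L2 Om g -> weak_derivative Om al u g ->
  ae_eq mu Om (wderiv Om al u) g.
Proof.
by move=> Lg wg; apply: weak_unique (wderiv_weak Lg wg) wg => //; exact: wderiv_L2.
Qed.

Lemma weak_lin al (t : R) u v g h : L2 Om u -> L2 Om v -> L2 Om g -> L2 Om h ->
  weak_derivative Om al u g -> weak_derivative Om al v h ->
  weak_derivative Om al (fun x => t * u x + v x) (fun x => t * g x + h x).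
Proof.
move=> Lu Lv Lg Lh wg wh phi tphi.
rewrite -/(ip Om _ (mderiv al phi)) -/(ip Om (fun x => t * g x + h x) phi).
have Lphi := tL2 tphi; have Lal := tL2 (test_mderiv al tphi).
rewrite !ip_lin//.
have -> : ip Om u (mderiv al phi) = (-1) ^+ mlength al * ip Om g phi by exact: wg.
have -> : ip Om v (mderiv al phi) = (-1) ^+ mlength al * ip Om h phi by exact: wh.
by ring.
Qed.

Lemma sobolev_L2 k u : sobolev Om k u -> L2 Om u. Proof. by case. Qed.

Lemma sobolev_weak k u al : sobolev Om k u -> (mlength al <= k)%N ->
  weak_derivative Om al u (wderiv Om al u).
Proof. by move=> [_ wu] /wu[g [Lg wg]]; exact: wderiv_weak wg. Qed.

Lemma sobolev_lin k (t : R) u v : sobolev Om k u -> sobolev Om k v ->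
  sobolev Om k (fun x => t * u x + v x).
Proof.
move=> su sv; have [Lu _] := su; have [Lv _] := sv.
split; first exact: L2_lin.
move=> al alk; exists (fun x => t * wderiv Om al u x + wderiv Om al v x).
split; first by apply: L2_lin => //; exact: wderiv_L2.
by apply: weak_lin => //; [exact: wderiv_L2|exact: wderiv_L2|
  exact: sobolev_weak alk|exact: sobolev_weak alk].
Qed.

Lemma wderiv_lin k al (t : R) u v : sobolev Om k u -> sobolev Om k v ->
  (mlength al <= k)%N ->
  ae_eq mu Om (wderiv Om al (fun x => t * u x + v x))
    (fun x => t * wderiv Om al u x + wderiv Om al v x).
Proof.
move=> su sv alk; have [Lu _] := su; have [Lv _] := sv.
apply: wderiv_ae; first by apply: L2_lin => //; exact: wderiv_L2.
by apply: weak_lin => //; [exact: wderiv_L2|exact: wderiv_L2|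
  exact: sobolev_weak alk|exact: sobolev_weak alk].
Qed.

Lemma wderiv0 al u : L2 Om u -> mlength al = 0%N ->
  ae_eq mu Om (wderiv Om al u) u.
Proof.
move=> Lu al0; apply: wderiv_ae => // phi tphi.
by rewrite al0 expr0 mul1r mderiv0.
Qed.

Lemma wpartialE i u : wpartial Om i u = wderiv Om (unit_index i) u.
Proof. by []. Qed.

Lemma weak_unitP i u g : weak_derivative Om (unit_index i) u g <->
  forall phi, test_function Om phi -> ip Om u (partial i phi) = - ip Om g phi.
Proof.
by split=> h phi tphi; have := h phi tphi; rewrite mlength_unit mderiv_unit expr1 mulN1r.
Qed.

(** The derivative of [eta] vanishes off [Om], so the integral may be taken
    over the whole space. *)
Lemma test_partial_int0 eta i : test_function Om eta ->
  \int[mu]_(x in Om) partial i eta x = 0.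
Proof.
move=> teta; have tp := test_partial i teta.
rewrite Rintegral_mkcond.
have -> : (partial i eta) \_ Om = partial i eta.
  apply/funext => x; rewrite patchE; case: ifPn => //; rewrite notin_setE => nOm.
  by rewrite (test_out tp).
have [K hK] := test_bounded tp; have [M hM] := test_cube teta.
rewrite /Rintegral (@integral_partial _ _ i eta M K)//.
- by move=> x; exact: (smooth_on_derivable (test_smooth teta)).
- exact: test_continuous tp.
Qed.

(** [a * phi] is a test function, so its derivative has integral zero. *)
Lemma test_parts a phi i : smooth_on Om a -> test_function Om phi ->
  L2 Om a -> L2 Om (partial i a) ->
  ip Om a (partial i phi) = - ip Om (partial i a) phi.
Proof.
move=> sa tphi La Lpa; have taphi := test_mul oOm sa tphi.
have Lphi := tL2 tphi; have Lpphi := tL2 (test_partial i tphi).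
apply/eqP; rewrite -addr_eq0 -(test_partial_int0 i taphi); apply/eqP.
rewrite /ip -RintegralD//; [|exact: L2_integrableM|exact: L2_integrableM].
apply: eq_Rintegral => x; rewrite inE => Omx.
have da := smooth_on_derivable sa Omx (i := i).
have dphi := smooth_on_derivable (test_smooth tphi) (I : setT x) (i := i).
by rewrite /partial (deriveM da dphi) [X in _ + X]mulrC.
Qed.

Lemma test_weak_unit phi i : test_function Om phi ->
  weak_derivative Om (unit_index i) phi (partial i phi).
Proof.
move=> tphi; apply/weak_unitP => psi tpsi; apply: test_parts => //.
- exact: smooth_on_subset (@subsetT _ Om) (test_smooth tphi).
- exact: tL2.
- exact: tL2 (test_partial i tphi).
Qed.

Lemma test_sobolev1 phi : test_function Om phi -> sobolev Om 1 phi.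
Proof.
move=> tphi; split; first exact: tL2.
move=> al /mlength_le1[al0|[i ->]].
  exists phi; split; first exact: tL2.
  by move=> psi tpsi; rewrite al0 expr0 mul1r mderiv0.
exists (partial i phi); split; last exact: test_weak_unit.
exact: tL2 (test_partial i tphi).
Qed.

Lemma closure_compact : compact (closure Om).
Proof.
have [M _ hM] := bounded_set_coord bOm.
have cB := @closed_box_compact R d (fun=> - M) (fun=> M).
apply: (subclosed_compact _ cB); first exact: closed_closure.
apply: closure_min => [|x Omx i].
  by apply: compact_closed cB; exact: norm_hausdorff.
by rewrite -ler_norml; exact: hM.
Qed.

(** The continuous extension to the compact closure is bounded. *)
Lemma smooth_on_closure_bound a s : smooth_on_closure Om a ->
  exists K, forall x, Om x -> `|foldr partial a s x| <= K.
Proof.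
move=> [_ /(_ s)[h [ch ha]]].
have /compact_bounded[M [_ hM]] := continuous_compact ch closure_compact.
exists (`|M| + 1) => x Omx; rewrite -ha//.
apply: (hM (`|M| + 1)); first by rewrite (le_lt_trans (ler_norm _))// ltrDl.
by exists x => //; exact: subset_closure.
Qed.

Lemma smooth_on_measurable a s : smooth_on Om a ->
  measurable_fun Om (foldr partial a s).
Proof.
move=> sa; apply: continuous_on_measurable => // x Omx.
by have [] := sa s x Omx.
Qed.

Lemma smooth_on_closure_L2 a s u : smooth_on_closure Om a -> L2 Om u ->
  L2 Om (fun x => foldr partial a s x * u x).
Proof.
move=> sa Lu; have [K hK] := smooth_on_closure_bound s sa.
apply: (L2_bM mOm _ hK) => //.
by apply: smooth_on_measurable; case: sa.
Qed.

(** The product rule: test the weak derivative of [u] with [a * phi], which is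
    again a test function. *)
Lemma weak_mul a i u g : smooth_on_closure Om a -> L2 Om u -> L2 Om g ->
  weak_derivative Om (unit_index i) u g ->
  weak_derivative Om (unit_index i) (fun x => a x * u x)
    (fun x => partial i a x * u x + a x * g x).
Proof.
move=> sa Lu Lg /weak_unitP wg; apply/weak_unitP => phi tphi.
have [sOma _] := sa; have taphi := test_mul oOm sOma tphi.
have Lau := smooth_on_closure_L2 [::] sa Lu.
have Lag := smooth_on_closure_L2 [::] sa Lg.
have Lpau := smooth_on_closure_L2 [:: i] sa Lu.
have Lphi := tL2 tphi; have Lpphi := tL2 (test_partial i tphi).
have Lapp := smooth_on_closure_L2 [::] sa Lpphi.
have Lpap := smooth_on_closure_L2 [:: i] sa Lphi.
have -> : ip Om (fun x => a x * u x) (partial i phi) =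
    ip Om u (partial i (a * phi)) - ip Om u (fun x => partial i a x * phi x).
  rewrite -ipBr//; last exact: tL2 (test_partial i taphi).
  apply: eq_Rintegral => x; rewrite inE => Omx /=.
  have da := smooth_on_derivable sOma Omx (i := i).
  have dphi := smooth_on_derivable (test_smooth tphi) (I : setT x) (i := i).
  by rewrite /partial (deriveM da dphi) /GRing.scale /=; ring.
rewrite wg// ipD// opprD addrC; congr (- _ - _).
- by apply: eq_Rintegral => x _; rewrite mulrA (mulrC (u x)).
- by apply: eq_Rintegral => x _; rewrite mulrA (mulrC (g x)).
Qed.

(** Test the first weak derivative with [partial j phi]. *)
Lemma weak_second i j u : sobolev Om 2 u ->
  weak_derivative Om (unit_index j) (wpartial Om i u) (wderiv Om (pair_index i j) u).
Proof.
move=> su; apply/weak_unitP => phi tphi.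
have w1 : weak_derivative Om (unit_index i) u (wpartial Om i u).
  by apply: sobolev_weak su _; rewrite mlength_unit.
have E1 := (weak_unitP _ _ _).1 w1 _ (test_partial j tphi).
have w2 : weak_derivative Om (pair_index i j) u (wderiv Om (pair_index i j) u).
  by apply: sobolev_weak su _; rewrite mlength_pair.
have := w2 phi tphi; rewrite mlength_pair sqrrN expr1n mul1r.
rewrite (mderiv_pair _ _ (test_smooth tphi)) => E2.
by rewrite -[LHS]opprK -E1; congr (- _); exact: E2.
Qed.

End weak_derivatives.

(** * Sequences converging to zero in L2 *)

Section L2_null.
Context {R : realType} {d : nat} {Om : set 'rV[R]_d}.
Hypothesis mOm : measurable Om.
Local Notation mu := (@lebesgue_rV R d).
Implicit Types (p q : nat -> 'rV[R]_d -> R).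

Definition L2_null p := (forall n, L2 Om (p n)) /\
  ip Om (p n) (p n) @[n --> \oo] --> (0 : R).

Lemma L2_null_le p q (K : R) : L2_null p -> (forall n, L2 Om (q n)) ->
  (forall n, ip Om (q n) (q n) <= K * ip Om (p n) (p n)) -> L2_null q.
Proof.
move=> [Lp p0] Lq qp; split => //.
apply: (@squeeze_cvgr _ _ _ _ (fun=> 0) (fun n => K * ip Om (p n) (p n))).
- by apply: nearW => n; rewrite ip_ge0 qp.
- exact: cvg_cst.
- by rewrite [X in _ --> X](_ : 0 = K * 0); [apply: cvgMr|rewrite mulr0].
Qed.

Lemma L2_nullD p q : L2_null p -> L2_null q -> L2_null (fun n => p n \+ q n).
Proof.
move=> [Lp p0] [Lq q0]; split; first by move=> n; exact: L2D.
apply: (@squeeze_cvgr _ _ _ _ (fun=> 0)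
  (fun n => 2 * ip Om (p n) (p n) + 2 * ip Om (q n) (q n))).
- by apply: nearW => n; rewrite ip_ge0 ip_sqrD.
- exact: cvg_cst.
- rewrite [X in _ --> X](_ : 0 = 2 * 0 + 2 * 0); last by rewrite mulr0 addr0.
  by apply: cvgD; apply: cvgMr.
Qed.

Lemma L2_null_bM (b : 'rV[R]_d -> R) (K : R) p : measurable_fun Om b ->
  (forall x, Om x -> `|b x| <= K) -> L2_null p -> L2_null (fun n x => b x * p n x).
Proof.
move=> mb bK p0; have [Lp _] := p0; apply: (L2_null_le (K := K ^+ 2) p0).
  by move=> n; exact: L2_bM mb bK _.
by move=> n; exact: ip_sqr_bM.
Qed.

Lemma L2_nullZ (t : R) p : L2_null p -> L2_null (fun n x => t * p n x).
Proof. exact: (@L2_null_bM (cst t) `|t|). Qed.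

Lemma L2_null_sum (I : Type) (r : seq I) (F : I -> nat -> 'rV[R]_d -> R) :
  (forall i, L2_null (F i)) -> L2_null (fun n x => \sum_(i <- r) F i n x).
Proof.
move=> F0; elim: r => [|i r ih].
  rewrite (_ : (fun n x => _) = fun=> cst 0); last first.
    by apply/funext => n; apply/funext => x; rewrite big_nil.
  split=> [n|]; first exact: L2_cst0.
  rewrite (_ : ip Om (cst 0) (cst 0) = 0); first exact: cvg_cst.
  rewrite /ip (@eq_Rintegral _ _ _ _ _ (cst 0)) ?Rintegral_cst ?mul0r//.
  by move=> x _; rewrite /= mul0r.
have := L2_nullD (F0 i) ih; congr L2_null.
by apply/funext => n; apply/funext => x; rewrite big_cons.
Qed.

Lemma L2_null_ae p q : (forall n, L2 Om (q n)) ->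
  (forall n, ae_eq mu Om (q n) (p n)) -> L2_null p -> L2_null q.
Proof.
move=> Lq qp p0; have [Lp _] := p0; apply: (L2_null_le (K := 1) p0) => // n.
by rewrite mul1r (@ip_ae _ _ _ mOm _ (p n) _ (p n))//; apply: L2_measurable.
Qed.

End L2_null.

(** * Sobolev spaces *)

Section sobolev_facts.
Context {R : realType} {d : nat} {Om : set 'rV[R]_d}.
Hypotheses (oOm : open Om) (bOm : bounded_set Om).
Local Notation mu := (@lebesgue_rV R d).
Implicit Types (al : 'I_d -> nat) (a u v g h phi psi : 'rV[R]_d -> R).

Let mOm : measurable Om := open_rV_measurable oOm.
Let fOm : (mu Om < +oo)%E := bounded_measure_fin mOm bOm.
Let tL2 phi := @test_L2 R d Om phi mOm fOm.

Lemma funB_lin u v : u \- v = (fun x => -1 * v x + u x).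
Proof. by apply/funext => x /=; rewrite mulN1r addrC. Qed.

Lemma sobolevB k u v : sobolev Om k u -> sobolev Om k v -> sobolev Om k (u \- v).
Proof. by move=> su sv; rewrite funB_lin; exact: sobolev_lin. Qed.

Lemma wderivB k al u v : sobolev Om k u -> sobolev Om k v -> (mlength al <= k)%N ->
  ae_eq mu Om (wderiv Om al (u \- v)) (wderiv Om al u \- wderiv Om al v).
Proof. by move=> su sv alk; rewrite !funB_lin; exact: (wderiv_lin _ _ _ sv su alk). Qed.

Lemma sobolev_norm_sum_ge0 k u :
  0 <= \sum_(al : {ffun 'I_d -> 'I_k.+1} | (mlength (fun i => al i) <= k)%N)
    \int[mu]_(x in Om) (wderiv Om (fun i => al i) u x ^+ 2).
Proof. by apply: sumr_ge0 => al _; rewrite ip_sqr ip_ge0. Qed.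

(** An index of length at most [k] has entries at most [k], so it occurs in the
    sum. *)
Lemma sobolev_norm_term k al u : (mlength al <= k)%N ->
  ip Om (wderiv Om al u) (wderiv Om al u) <= sobolev_norm Om k u ^+ 2.
Proof.
move=> alk; rewrite /sobolev_norm sqr_sqrtr ?sobolev_norm_sum_ge0//.
have alE : (fun i => ([ffun i => inord (al i)] : {ffun 'I_d -> 'I_k.+1}) i : nat) = al.
  apply/funext => i; rewrite ffunE inordK// ltnS.
  exact: leq_trans (mlength_ge al i) alk.
rewrite (bigD1 [ffun i => inord (al i)]) /= ?alE// lerDl.
by apply: sumr_ge0 => ? _; rewrite ip_sqr ip_ge0.
Qed.

Lemma sobolev_norm_null k (v_ : nat -> 'rV[R]_d -> R) al : (mlength al <= k)%N ->
  sobolev_norm Om k (v_ n) @[n --> \oo] --> (0 : R) ->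
  L2_null (Om := Om) (fun n => wderiv Om al (v_ n)).
Proof.
move=> alk v0; split; first by move=> n; exact: wderiv_L2.
apply: (@squeeze_cvgr _ _ _ _ (fun=> 0) (fun n => sobolev_norm Om k (v_ n) ^+ 2)).
- by apply: nearW => n; rewrite ip_ge0 sobolev_norm_term.
- exact: cvg_cst.
- rewrite [X in _ --> X](_ : 0 = 0 * 0); last by rewrite mulr0.
  by under eq_fun do rewrite expr2; exact: cvgM.
Qed.

Lemma null_sobolev_norm k (v_ : nat -> 'rV[R]_d -> R) :
  (forall al, (mlength al <= k)%N -> L2_null (Om := Om) (fun n => wderiv Om al (v_ n))) ->
  sobolev_norm Om k (v_ n) @[n --> \oo] --> (0 : R).
Proof.
move=> v0.
have h : \sum_(al : {ffun 'I_d -> 'I_k.+1} | (mlength (fun i => al i) <= k)%N)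
    \int[mu]_(x in Om) (wderiv Om (fun i => al i) (v_ n) x ^+ 2) @[n --> \oo] --> (0 : R).
  rewrite [X in _ --> X](_ : 0 = \sum_(al : {ffun 'I_d -> 'I_k.+1} |
      (mlength (fun i => al i) <= k)%N) 0); last by rewrite big1.
  apply: cvg_big => [|al alk]; first exact: add_continuous.
  by have [_] := v0 _ alk.
by have := cvg_comp _ _ h (@sqrt_continuous R 0); rewrite sqrtr0.
Qed.

Lemma sobolev10_lin (t : R) u v : sobolev10 Om u -> sobolev10 Om v ->
  sobolev10 Om (fun x => t * u x + v x).
Proof.
move=> [su [phi [tphi phiu]]] [sv [psi [tpsi psiv]]].
split; first exact: sobolev_lin.
exists (fun n x => t * phi n x + psi n x); split; first by move=> n; exact: test_lin.
apply: null_sobolev_norm => al al1.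
have sd n : sobolev Om 1 (phi n \- u).
  by apply: sobolevB => //; exact: test_sobolev1.
have se n : sobolev Om 1 (psi n \- v).
  by apply: sobolevB => //; exact: test_sobolev1.
have hu := sobolev_norm_null al1 phiu; have hv := sobolev_norm_null al1 psiv.
apply: (L2_null_ae mOm _ _ (L2_nullD mOm (L2_nullZ mOm t hu) hv)).
  by move=> n; exact: wderiv_L2.
move=> n.
rewrite (_ : _ \- _ = (fun x => t * (phi n \- u) x + (psi n \- v) x)).
  exact: (wderiv_lin oOm bOm t (sd n) (se n) al1).
by apply/funext => x /=; ring.
Qed.

Lemma sobolev10B u v : sobolev10 Om u -> sobolev10 Om v -> sobolev10 Om (u \- v).
Proof. by move=> u10 v10; rewrite funB_lin; exact: sobolev10_lin. Qed.

(** The classical derivatives of a test function are weak ones, so by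
    uniqueness they replace the weak derivatives in the distance of [H^1]. *)
Lemma sobolev10_approx v : sobolev10 Om v -> exists phi : nat -> 'rV[R]_d -> R,
  [/\ forall n, test_function Om (phi n), L2_null (Om := Om) (fun n => phi n \- v) &
    forall i, L2_null (Om := Om) (fun n => partial i (phi n) \- wpartial Om i v)].
Proof.
move=> [sv [phi [tphi phiv]]]; exists phi; split => //.
- have z1 : (mlength (fun _ : 'I_d => 0%N) <= 1)%N by rewrite /mlength big1.
  have z0 : mlength (fun _ : 'I_d => 0%N) = 0%N by rewrite /mlength big1.
  have Ld n : L2 Om (phi n \- v).
    by apply: L2B => //; [exact: tL2|exact: sobolev_L2 sv].
  apply: (L2_null_ae mOm _ _ (sobolev_norm_null z1 phiv)) => // n.
  by apply: ae_eq_sym; exact: wderiv0.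
- move=> i; have u1 : (mlength (unit_index i) <= 1)%N by rewrite mlength_unit.
  have Lp n : L2 Om (partial i (phi n)) by exact: tL2 (test_partial i (tphi n)).
  apply: (L2_null_ae mOm _ _ (sobolev_norm_null u1 phiv)) => n.
    by apply: L2B => //; exact: wderiv_L2.
  have := wderivB (test_sobolev1 oOm bOm (tphi n)) sv u1.
  have := wderiv_ae oOm bOm (Lp n) (test_weak_unit oOm bOm i (tphi n)).
  by apply: filterS2 => x E1 E2 Omx; rewrite E2//= E1.
Qed.

End sobolev_facts.

(** * The elliptic operator *)

Section elliptic.
Context {R : realType} {d : nat} {Om : set 'rV[R]_d}.
Hypotheses (oOm : open Om) (bOm : bounded_set Om).
Local Notation mu := (@lebesgue_rV R d).
Implicit Types (u v phi : 'rV[R]_d -> R).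

Let mOm : measurable Om := open_rV_measurable oOm.
Let fOm : (mu Om < +oo)%E := bounded_measure_fin mOm bOm.
Let tL2 phi := @test_L2 R d Om phi mOm fOm.

Variables (a : 'I_d -> 'I_d -> 'rV[R]_d -> R) (c : 'rV[R]_d -> R).
Hypothesis sa : forall i j, smooth_on_closure Om (a i j).
Hypothesis sc : smooth_on_closure Om c.

Local Notation L := (elliptic_op Om a c).

Definition flux i j u : 'rV[R]_d -> R := fun y => a i j y * wpartial Om i u y.

Lemma wpartial_L2 i u : L2 Om (wpartial Om i u).
Proof. exact: wderiv_L2. Qed.

Lemma flux_L2 i j u : L2 Om (flux i j u).
Proof.
exact: (smooth_on_closure_L2 oOm bOm [::] (sa i j) (wpartial_L2 i u)).
Qed.

Lemma cu_L2 u : L2 Om u -> L2 Om (fun x => c x * u x).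
Proof. exact: (smooth_on_closure_L2 oOm bOm [::] sc). Qed.

Lemma flux_weak i j u : sobolev Om 2 u ->
  weak_derivative Om (unit_index j) (flux i j u)
   (fun x => partial j (a i j) x * wpartial Om i u x +
             a i j x * wderiv Om (pair_index i j) u x).
Proof.
move=> su; apply: weak_mul => //; [exact: wpartial_L2|exact: wderiv_L2|].
exact: weak_second.
Qed.

Lemma flux_weak_L2 i j u :
  L2 Om (fun x => partial j (a i j) x * wpartial Om i u x +
             a i j x * wderiv Om (pair_index i j) u x).
Proof.
apply: L2D => //.
  exact: (smooth_on_closure_L2 oOm bOm [:: j] (sa i j) (wpartial_L2 i u)).
exact: (smooth_on_closure_L2 oOm bOm [::] (sa i j) (wderiv_L2 _ _ _)).
Qed.

Lemma elliptic_L2 u : L2 Om u -> L2 Om (L u).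
Proof.
move=> Lu; apply: L2D => //; last exact: cu_L2.
by apply: L2N => //; apply: L2_sum => // i; apply: L2_sum => // j; exact: wpartial_L2.
Qed.

Lemma elliptic_weak u phi : sobolev Om 2 u -> test_function Om phi ->
  ip Om (L u) phi = \sum_(i < d) \sum_(j < d) ip Om (flux i j u) (partial j phi)
    + ip Om (fun x => c x * u x) phi.
Proof.
move=> su tphi; have Lphi := tL2 tphi; have Lu := sobolev_L2 su.
have Lj i j : L2 Om (wpartial Om j (flux i j u)) by exact: wpartial_L2.
have Ls i : L2 Om (fun x => \sum_(j < d) wpartial Om j (flux i j u) x).
  by apply: L2_sum => // j; exact: Lj.
have LS : L2 Om (fun x => \sum_(i < d) \sum_(j < d) wpartial Om j (flux i j u) x).
  by apply: L2_sum => // i; exact: Ls.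
transitivity (ip Om ((fun x => - \sum_(i < d) \sum_(j < d)
    wpartial Om j (flux i j u) x) \+ (fun x => c x * u x)) phi); first by [].
rewrite ipD//; [|exact: L2N|exact: cu_L2].
congr (_ + _); rewrite ipN// ip_sum// -sumrN; apply: eq_bigr => i _.
rewrite ip_sum// -sumrN; apply: eq_bigr => j _.
have := wderiv_weak (flux_weak_L2 i j u) (flux_weak i j su).
by move=> /weak_unitP ->.
Qed.

Lemma ip_flux_lin i j (t : R) u v psi : sobolev Om 2 u -> sobolev Om 2 v ->
  L2 Om psi ->
  ip Om (flux i j (fun x => t * u x + v x)) psi =
  t * ip Om (flux i j u) psi + ip Om (flux i j v) psi.
Proof.
move=> su sv Lpsi; have Fu := flux_L2 i j u; have Fv := flux_L2 i j v.
rewrite -ip_lin//; apply: (ip_ae mOm).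
- exact: L2_measurable (flux_L2 i j _).
- exact: L2_measurable (L2_lin mOm t Fu Fv).
- exact: L2_measurable Lpsi.
- exact: L2_measurable Lpsi.
- have u2 : (mlength (unit_index i) <= 2)%N by rewrite mlength_unit.
  have := wderiv_lin oOm bOm t su sv u2; rewrite -!wpartialE.
  by apply: filterS => x E Omx; rewrite /flux (E Omx); ring.
- exact: ae_eq_refl.
Qed.

(** Each term of [elliptic_op] is a representative chosen separately for each
    function; linearity holds almost everywhere because the weak formulation is
    linear and determines the operator. *)
Lemma elliptic_lin (t : R) u v : sobolev Om 2 u -> sobolev Om 2 v ->
  ae_eq mu Om (L (fun x => t * u x + v x)) (fun x => t * L u x + L v x).
Proof.
move=> su sv; have suv := sobolev_lin oOm bOm t su sv.
have Lu := sobolev_L2 su; have Lv := sobolev_L2 sv; have Luv := sobolev_L2 suv.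
have LLu := elliptic_L2 Lu; have LLv := elliptic_L2 Lv; have LLuv := elliptic_L2 Luv.
have Lr : L2 Om (fun x => t * L u x + L v x) by exact: L2_lin.
have : ae_eq mu Om (L (fun x => t * u x + v x) \- (fun x => t * L u x + L v x)) (cst 0).
  apply: fundamental_lemma => //; first exact: L2B.
  move=> phi tphi; have Lphi := tL2 tphi.
  rewrite ipB// ip_lin// !elliptic_weak//.
  have combine (A X A1 X1 A2 X2 : R) : A = t * A1 + A2 -> X = t * X1 + X2 ->
      A + X - (t * (A1 + X1) + (A2 + X2)) = 0 by move=> -> ->; ring.
  apply: combine.
    rewrite mulr_sumr -big_split /=; apply: eq_bigr => i _.
    rewrite mulr_sumr -big_split /=; apply: eq_bigr => j _.
    by apply: ip_flux_lin => //; exact: tL2 (test_partial j tphi).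
  rewrite -ip_lin//; [|exact: cu_L2|exact: cu_L2].
  by apply: eq_Rintegral => x _; ring.
by apply: filterS => x E Omx; apply/eqP; rewrite -subr_eq0; apply/eqP; exact: E.
Qed.

Lemma ellipticB u v : sobolev Om 2 u -> sobolev Om 2 v ->
  ae_eq mu Om (L (u \- v)) (L u \- L v).
Proof. by move=> su sv; rewrite !funB_lin; exact: elliptic_lin. Qed.

(** The product rule bounds the divergence of the fluxes by the derivatives of
    order at most two. *)
Lemma elliptic_null (v_ : nat -> 'rV[R]_d -> R) : (forall n, sobolev Om 2 (v_ n)) ->
  sobolev_norm Om 2 (v_ n) @[n --> \oo] --> (0 : R) ->
  L2_null (Om := Om) (fun n => L (v_ n)).
Proof.
move=> sv v0.
have z2 : (mlength (fun _ : 'I_d => 0%N) <= 2)%N by rewrite /mlength big1.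
have z0 : mlength (fun _ : 'I_d => 0%N) = 0%N by rewrite /mlength big1.
have vnull : L2_null (Om := Om) v_.
  apply: (@L2_null_ae _ _ _ mOm _ v_ _ _ (sobolev_norm_null oOm z2 v0)) => n.
    exact: sobolev_L2 (sv n).
  by apply: ae_eq_sym; apply: wderiv0 => //; exact: sobolev_L2 (sv n).
have bM b s (p : nat -> 'rV[R]_d -> R) : smooth_on_closure Om b -> L2_null (Om := Om) p ->
    L2_null (Om := Om) (fun n x => foldr partial b s x * p n x).
  move=> sb p0; have [K hK] := smooth_on_closure_bound bOm s sb.
  apply: (L2_null_bM mOm _ hK p0).
  by apply: smooth_on_measurable => //; case: sb.
have fnull i j : L2_null (Om := Om) (fun n => wpartial Om j (flux i j (v_ n))).
  have e1 : (mlength (unit_index i) <= 2)%N by rewrite mlength_unit.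
  have e2 : (mlength (pair_index i j) <= 2)%N by rewrite mlength_pair.
  have h1 := bM _ [:: j] _ (sa i j) (sobolev_norm_null oOm e1 v0).
  have h2 := bM _ [::] _ (sa i j) (sobolev_norm_null oOm e2 v0).
  apply: (L2_null_ae mOm _ _ (L2_nullD mOm h1 h2)) => n; first exact: wpartial_L2.
  exact: wderiv_ae (flux_weak_L2 i j _) (flux_weak i j (sv n)).
have Snull : L2_null (Om := Om) (fun n x => \sum_(i < d) \sum_(j < d)
    wpartial Om j (flux i j (v_ n)) x).
  by apply: L2_null_sum => // i; apply: L2_null_sum.
have := L2_nullD mOm (L2_nullZ mOm (-1) Snull) (bM _ [::] _ sc vnull).
congr L2_null; apply/funext => n; apply/funext => x.
by rewrite /elliptic_op /= mulN1r.
Qed.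

End elliptic.

(** * Coercivity *)

Section coercivity.
Context {R : realType} {d : nat} {Om : set 'rV[R]_d}.
Hypotheses (oOm : open Om) (bOm : bounded_set Om).
Local Notation mu := (@lebesgue_rV R d).
Implicit Types (u v phi : 'rV[R]_d -> R).

Let mOm : measurable Om := open_rV_measurable oOm.
Let fOm : (mu Om < +oo)%E := bounded_measure_fin mOm bOm.
Let tL2 phi := @test_L2 R d Om phi mOm fOm.

Lemma cvg_le_compat (f g : nat -> R) (l m : R) : f n @[n --> \oo] --> l ->
  g n @[n --> \oo] --> m -> (forall n, f n <= g n) -> l <= m.
Proof. by move=> fl gm fg; apply: (ler_cvg_to fl gm); exact: nearW. Qed.

(** Integrating [phi ^+ 2] by parts against the coordinate gives
    [ip phi phi = - 2 ip (x_i d_i phi) phi]; half of the left-hand side absorbs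
    what Young's inequality leaves of it. *)
Lemma poincare_test (M : R) i phi : (forall x, Om x -> `|x ord0 i| <= M) ->
  test_function Om phi ->
  ip Om phi phi <= 4 * M ^+ 2 * ip Om (partial i phi) (partial i phi).
Proof.
move=> OmM tphi; have Lphi := tL2 tphi.
have tp := test_partial i tphi; have Lp := tL2 tp.
have sx : smooth_on Om (fun y : 'rV[R]_d => y ord0 i).
  exact: smooth_on_subset (@subsetT _ Om) (coord_smooth i).
have mx : measurable_fun Om (fun y : 'rV[R]_d => y ord0 i).
  exact: (smooth_on_measurable oOm [::] sx).
have txphi := test_mul oOm sx tphi.
have Lxp : L2 Om (fun x => x ord0 i * partial i phi x).
  exact: (L2_bM mOm mx OmM Lp).
have E := test_parts oOm bOm (smooth_on_subset (@subsetT _ Om) (test_smooth txphi))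
  tphi (tL2 txphi) (tL2 (test_partial i txphi)).
have E1 : ip Om ((fun y : 'rV[R]_d => y ord0 i) * phi) (partial i phi) =
    ip Om (fun x => x ord0 i * partial i phi x) phi.
  by apply: eq_Rintegral => x _; rewrite mulrAC.
have E2 : ip Om (partial i ((fun y : 'rV[R]_d => y ord0 i) * phi)) phi =
    ip Om (fun x => x ord0 i * partial i phi x) phi + ip Om phi phi.
  rewrite -ipD//; apply: eq_Rintegral => x _; congr (_ * _).
  have [dx px] := partial_coord i i x.
  have dphi := smooth_on_derivable (test_smooth tphi) (I : setT x) (i := i).
  rewrite /partial (deriveM dx dphi) px.
  by rewrite eqxx; congr (_ + _); exact: mulr1.
rewrite E1 E2 in E.
have Y := ip_young mOm (e := 2^-1) _ (L2N mOm Lxp) Lphi.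
rewrite ipN// invrK in Y; have {}Y := Y ltac:(by rewrite invr_gt0).
have B := ip_sqr_bM mOm mx OmM Lp.
have N : ip Om (fun x => - (x ord0 i * partial i phi x))
    (fun x => - (x ord0 i * partial i phi x)) =
  ip Om (fun x => x ord0 i * partial i phi x) (fun x => x ord0 i * partial i phi x).
  by apply: eq_Rintegral => x _; rewrite mulrNN.
rewrite N in Y; move: E Y B; clear.
set X := ip Om _ phi; set P := ip Om phi phi; set Q := ip Om (fun x => _) (fun x => _).
by lra.
Qed.

Lemma poincare (M : R) i v : (forall x, Om x -> `|x ord0 i| <= M) ->
  sobolev10 Om v ->
  ip Om v v <= 4 * M ^+ 2 * ip Om (wpartial Om i v) (wpartial Om i v).
Proof.
move=> OmM v10; have Lv := sobolev_L2 v10.1.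
have [phi [tphi [_ phiv] dphiv]] := sobolev10_approx oOm bOm v10.
have [_ {}dphiv] := dphiv i.
have c1 := ip_cvg_sqr mOm (fun n => tL2 (tphi n)) Lv phiv.
have c2 := ip_cvg_sqr mOm (fun n => tL2 (test_partial i (tphi n)))
  (wderiv_L2 oOm _ _) dphiv.
apply: (cvg_le_compat c1 (g := fun n => 4 * M ^+ 2 *
  ip Om (partial i (phi n)) (partial i (phi n)))).
  by apply: cvgMr.
by move=> n; exact: poincare_test.
Qed.

Variables (a : 'I_d -> 'I_d -> 'rV[R]_d -> R) (c : 'rV[R]_d -> R).
Hypothesis ell : elliptic_coefficients Om a c.

Let sa : forall i j, smooth_on_closure Om (a i j). Proof. by case: ell => _ []. Qed.
Let sc : smooth_on_closure Om c. Proof. by case: ell => _ [_ []]. Qed.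

Local Notation L := (elliptic_op Om a c).

(** The weak formulation is the case of a test function, and both sides are
    continuous for the convergence in [H^1]. *)
Lemma green v : sobolev Om 2 v -> sobolev10 Om v ->
  ip Om (L v) v = \sum_(i < d) \sum_(j < d)
      ip Om (flux (Om := Om) a i j v) (wpartial Om j v) + ip Om (fun x => c x * v x) v.
Proof.
move=> sv v10; have Lv := sobolev_L2 v10.1.
have [phi [tphi [_ phiv] dphiv]] := sobolev10_approx oOm bOm v10.
have Lphi n := tL2 (tphi n).
have LLv : L2 Om (L v) := elliptic_L2 oOm bOm a sc Lv.
have c1 := ip_cvg mOm LLv Lphi Lv phiv.
have c2 := ip_cvg mOm (cu_L2 oOm bOm sc Lv) Lphi Lv phiv.
have c3 i j : ip Om (flux (Om := Om) a i j v) (partial j (phi n)) @[n --> \oo] -->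
    ip Om (flux (Om := Om) a i j v) (wpartial Om j v).
  apply: ip_cvg => //; first exact: flux_L2.
  - by move=> n; exact: tL2 (test_partial j (tphi n)).
  - exact: wpartial_L2.
  - by have [] := dphiv j.
apply: cvg_unique c1 _ => //.
rewrite (_ : (fun n => ip Om (L v) (phi n)) = (fun n =>
   \sum_(i < d) \sum_(j < d) ip Om (flux (Om := Om) a i j v) (partial j (phi n)) +
   ip Om (fun x => c x * v x) (phi n))); last first.
  by apply/funext => n; exact: elliptic_weak.
apply: cvgD => //.
apply: cvg_big => [|i _]; first exact: add_continuous.
by apply: cvg_big => [|j _]; first exact: add_continuous.
Qed.

Lemma Rintegral_sum (I : Type) (r : seq I) (F : I -> 'rV[R]_d -> R) :
  (forall i, mu.-integrable Om (EFin \o F i)) ->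
  mu.-integrable Om (EFin \o (fun x => \sum_(i <- r) F i x)) /\
  \int[mu]_(x in Om) (\sum_(i <- r) F i x) = \sum_(i <- r) \int[mu]_(x in Om) F i x.
Proof.
move=> iF; elim: r => [|i r [ih1 ih2]].
  split; first by under eq_fun do rewrite big_nil; exact: integrable0.
  rewrite big_nil (@eq_Rintegral _ _ _ _ _ (cst 0)) ?Rintegral_cst ?mul0r//.
  by move=> x _; rewrite big_nil.
split.
  apply: eq_integrable (integrableD mOm (iF i) ih1) => //.
  by move=> x _; rewrite /= big_cons EFinD.
rewrite big_cons -ih2 -RintegralD//.
by apply: eq_Rintegral => x _; rewrite big_cons.
Qed.

(** Ellipticity bounds the Dirichlet integral by [ip (L v) v], the term with [c]
    being nonnegative. With the ellipticity constant [th] and the bound [M] of the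
    coordinates on [Om], Young's inequality with the parameter [th / (4 M^2)]
    splits this so that, by Poincare's inequality, the part with [v] is absorbed. *)
Lemma coercive (hd : (0 < d)%N) : exists C : R, forall v, sobolev Om 2 v ->
  sobolev10 Om v ->
  (forall i, ip Om (wpartial Om i v) (wpartial Om i v) <= C * ip Om (L v) (L v)) /\
  ip Om v v <= C * ip Om (L v) (L v).
Proof.
have [_ [_ [_ [c0 [th [th0 thP]]]]]] := ell.
have [M M0 OmM] := bounded_set_coord bOm.
exists (4 * M ^+ 2 / th ^+ 2 + 16 * M ^+ 4 / th ^+ 2) => v sv v10.
have Lv := sobolev_L2 v10.1.
have LLv : L2 Om (L v) := elliptic_L2 oOm bOm a sc Lv.
have Lw i : L2 Om (wpartial Om i v) := wpartial_L2 oOm i v.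
pose D := \sum_(i < d) ip Om (wpartial Om i v) (wpartial Om i v).
have Dge i : ip Om (wpartial Om i v) (wpartial Om i v) <= D.
  by rewrite /D (bigD1 i)//= lerDl; apply: sumr_ge0 => j _; exact: ip_ge0.
have PD : ip Om v v <= 4 * M ^+ 2 * D.
  apply: le_trans (poincare (i := Ordinal hd) _ v10) _; first by move=> x /OmM; exact.
  by rewrite ler_wpM2l// mulr_ge0// sqr_ge0.
have iF i j := L2_integrableM mOm (flux_L2 oOm bOm sa i j v) (Lw j).
have thD : th * D <= ip Om (L v) v.
  rewrite green//.
  have c_ge0 : 0 <= ip Om (fun x => c x * v x) v.
    apply: Rintegral_ge0 => x Omx; rewrite -mulrA mulr_ge0 ?(ltW (c0 _ Omx))//.
    by rewrite -expr2 sqr_ge0.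
  apply: le_trans (_ : \sum_(i < d) \sum_(j < d) ip Om (flux (Om := Om) a i j v)
     (wpartial Om j v) <= _); last by rewrite lerDl.
  have [iW eW] := Rintegral_sum (index_enum 'I_d)
    (fun i => L2_integrableM mOm (Lw i) (Lw i)).
  have iFi i := Rintegral_sum (index_enum 'I_d) (iF i).
  have [iG eG] := Rintegral_sum (index_enum 'I_d) (fun i => (iFi i).1).
  rewrite /D -eW -RintegralZl//.
  have -> : \sum_(i < d) \sum_(j < d) ip Om (flux (Om := Om) a i j v) (wpartial Om j v) =
     \int[mu]_(x in Om) (\sum_(i < d) \sum_(j < d)
        flux (Om := Om) a i j v x * wpartial Om j v x).
    by rewrite eG; apply: eq_bigr => i _; rewrite (iFi i).2.
  apply: le_Rintegral => //; first exact: (integrableZl mOm th iW).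
  move=> x Omx; have := thP x (\row_i wpartial Om i v x) Omx.
  under eq_bigr do rewrite mxE expr2.
  move=> /le_trans; apply; rewrite le_eqVlt; apply/orP; left; apply/eqP.
  by apply: eq_bigr => i _; apply: eq_bigr => j _; rewrite !mxE.
have Y := ip_young mOm (e := th / (4 * M ^+ 2)) _ LLv Lv.
have {}Y := Y ltac:(by rewrite divr_gt0// mulr_gt0// exprn_gt0).
have N0 := ip_ge0 Om (L v).
set N := ip Om (L v) (L v) in Y N0 *.
have th2 : 0 < th ^+ 2 by rewrite exprn_gt0.
have M2 : 0 < 4 * M ^+ 2 by rewrite mulr_gt0// exprn_gt0.
have DN : D <= 4 * M ^+ 2 / th ^+ 2 * N.
  have h : th / (4 * M ^+ 2) * ip Om v v <= th * D.
    by rewrite -mulrA ler_wpM2l ?(ltW th0)// ler_pdivrMl.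
  have {}Y : th * D <= (th / (4 * M ^+ 2))^-1 * N by lra.
  rewrite -(ler_pM2l th0) (le_trans Y)//.
  rewrite le_eqVlt; apply/orP; left; apply/eqP.
  by field; rewrite !gt_eqF.
have k1 : 0 <= 16 * M ^+ 4 / th ^+ 2 * N.
  by rewrite mulr_ge0// divr_ge0// ?ltW// mulr_gt0// exprn_gt0.
have k2 : 0 <= 4 * M ^+ 2 / th ^+ 2 * N.
  by rewrite mulr_ge0// divr_ge0// ltW.
split; first by move=> i; rewrite mulrDl (le_trans (Dge i))// (le_trans DN)// lerDl.
rewrite mulrDl (le_trans PD)//.
apply: le_trans (_ : 4 * M ^+ 2 * (4 * M ^+ 2 / th ^+ 2 * N) <= _).
  by rewrite ler_pM2l.
rewrite [leLHS](_ : _ = 16 * M ^+ 4 / th ^+ 2 * N) ?lerDr//.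
by field; rewrite gt_eqF.
Qed.

End coercivity.

(** * The regularised energy *)

Section energy_facts.
Context {R : realType} {d : nat} {Om : set 'rV[R]_d}.
Hypotheses (oOm : open Om) (bOm : bounded_set Om).
Local Notation mu := (@lebesgue_rV R d).
Implicit Types (u v w : 'rV[R]_d -> R).

Let mOm : measurable Om := open_rV_measurable oOm.

Variables (a : 'I_d -> 'I_d -> 'rV[R]_d -> R) (c f : 'rV[R]_d -> R).
Hypothesis ell : elliptic_coefficients Om a c.
Hypothesis Lf : L2 Om f.
Variables (lambda : R) (J : ('rV[R]_d -> R) -> R).

Let sa : forall i j, smooth_on_closure Om (a i j). Proof. by case: ell => _ []. Qed.
Let sc : smooth_on_closure Om c. Proof. by case: ell => _ [_ []]. Qed.

Local Notation L := (elliptic_op Om a c).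

Lemma ip_midpoint D B : L2 Om D -> L2 Om B ->
  ip Om (fun x => 2^-1 * D x + B x) (fun x => 2^-1 * D x + B x) =
  2^-1 * ip Om (D \+ B) (D \+ B) + 2^-1 * ip Om B B - 4^-1 * ip Om D D.
Proof.
move=> LD LB; have LDB := L2D mOm LD LB; have Lm := L2_lin mOm 2^-1 LD LB.
rewrite ip_lin// ![ip Om _ (fun x => 2^-1 * D x + B x)]ipC !ip_lin//.
by rewrite ipD// !ipDr// (ipC _ B D); field.
Qed.

Lemma energyE v : energy Om a c f v = ip Om (L v \- f) (L v \- f).
Proof. by apply: eq_Rintegral => x _; rewrite real_normK ?num_real. Qed.

Definition midpoint u v : 'rV[R]_d -> R := fun x => 2^-1 * (u \- v) x + v x.

(** The parallelogram identity for [L u - f] and [L v - f], whose difference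
    is [L (u - v)]. *)
Lemma energy_midpoint u v : sobolev Om 2 u -> sobolev Om 2 v ->
  energy Om a c f (midpoint u v) = 2^-1 * energy Om a c f u + 2^-1 * energy Om a c f v
    - 4^-1 * ip Om (L (u \- v)) (L (u \- v)).
Proof.
move=> su sv; have suv := sobolevB oOm bOm su sv.
have LL w : sobolev Om 2 w -> L2 Om (L w).
  by move=> sw; apply: (elliptic_L2 oOm bOm a sc); exact: sobolev_L2 sw.
pose D := L (u \- v); pose B := L v \- f.
have LD : L2 Om D by exact: LL.
have LB : L2 Om B by apply: L2B => //; exact: LL.
have Lu : L2 Om (L u \- f) by apply: L2B => //; exact: LL.
have smid : sobolev Om 2 (midpoint u v) by exact: sobolev_lin.
have Lmid : L2 Om (L (midpoint u v) \- f) by apply: L2B => //; exact: LL.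
have LDB : L2 Om (D \+ B) by exact: L2D.
have LDB2 : L2 Om (fun x => 2^-1 * D x + B x) by exact: L2_lin.
have Eu : ae_eq mu Om (L u \- f) (D \+ B).
  have := ellipticB oOm bOm sa sc su sv.
  by apply: filterS => x E Omx; rewrite /= /D /B E//=; ring.
have Em : ae_eq mu Om (L (midpoint u v) \- f) (fun x => 2^-1 * D x + B x).
  have := elliptic_lin oOm bOm sa sc 2^-1 suv sv.
  by apply: filterS => x E Omx; rewrite /= /D /B /midpoint E//=; ring.
rewrite !energyE.
rewrite (ip_ae mOm (L2_measurable Lmid) (L2_measurable LDB2)
  (L2_measurable Lmid) (L2_measurable LDB2) Em Em).
rewrite (ip_ae mOm (L2_measurable Lu) (L2_measurable LDB)
  (L2_measurable Lu) (L2_measurable LDB) Eu Eu).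
exact: ip_midpoint.
Qed.

Lemma energy_cvg (w_ : nat -> 'rV[R]_d -> R) u :
  (forall n, sobolev Om 2 (w_ n)) -> sobolev Om 2 u ->
  sobolev_norm Om 2 (w_ n \- u) @[n --> \oo] --> (0 : R) ->
  energy Om a c f (w_ n) @[n --> \oo] --> energy Om a c f u.
Proof.
move=> sw su wu; rewrite energyE; under eq_fun do rewrite energyE.
have LL w : sobolev Om 2 w -> L2 Om (L w \- f).
  move=> sw'; apply: L2B => //; apply: (elliptic_L2 oOm bOm a sc).
  exact: sobolev_L2 sw'.
apply: (ip_cvg_sqr mOm); [by move=> n; exact: LL|exact: LL|].
have sB n := sobolevB oOm bOm (sw n) su.
have := @L2_null_ae _ _ _ mOm _ (fun n => (L (w_ n) \- f) \- (L u \- f)) _ _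
  (elliptic_null oOm bOm sa sc sB wu).
case=> // n; first by apply: L2B => //; exact: LL.
have := ellipticB oOm bOm sa sc (sw n) su.
by apply: filterS => x E Omx; rewrite E//=; ring.
Qed.

Hypothesis lambda_gt0 : 0 < lambda.
Hypothesis J_convex : @convex_function R ('rV[R]_d -> R^o) (sobolev Om 2) J.

Lemma J_midpoint u v : sobolev Om 2 u -> sobolev Om 2 v ->
  J (midpoint u v) <= 2^-1 * J u + 2^-1 * J v.
Proof.
move=> su sv.
have h : J (fun x => 2^-1 * u x + (1 - 2^-1) * v x) <=
    2^-1 * J u + (1 - 2^-1) * J v.
  have half_ge0 : 0 <= 2^-1 :> R by rewrite invr_ge0.
  have half_le1 : 2^-1 <= 1 :> R by rewrite invf_le1// ler1n.
  exact: (J_convex (Itv01 half_ge0 half_le1) (mem_set su) (mem_set sv)).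
rewrite (_ : 2^-1 * J v = (1 - 2^-1) * J v); last by field.
apply: le_trans h; rewrite le_eqVlt; apply/orP; left; apply/eqP.
congr J; apply/funext => x.
by rewrite /midpoint /=; field.
Qed.

(** The midpoint of [v] and the minimiser [u] has at least the energy of [u],
    while by convexity of [J] it gains a quarter of the squared distance of [L v]
    and [L u] over the mean of the two energies. *)
Lemma minimiser_gap u v : sobolev Om 2 u -> sobolev10 Om u ->
  (forall v, sobolev Om 2 v -> sobolev10 Om v ->
     energy_reg Om a c f lambda J u <= energy_reg Om a c f lambda J v) ->
  sobolev Om 2 v -> sobolev10 Om v ->
  ip Om (L (v \- u)) (L (v \- u)) <=
  2 * (energy_reg Om a c f lambda J v - energy_reg Om a c f lambda J u).
Proof.
move=> su u10 umin sv v10.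
have smid : sobolev Om 2 (midpoint v u).
  exact: (sobolev_lin oOm bOm 2^-1 (sobolevB oOm bOm sv su) su).
have mid10 : sobolev10 Om (midpoint v u).
  exact: (sobolev10_lin oOm bOm 2^-1 (sobolev10B oOm bOm v10 u10) u10).
have := umin _ smid mid10; rewrite /energy_reg energy_midpoint//.
have := ler_wpM2l (ltW lambda_gt0) (J_midpoint sv su).
by rewrite mulrDr !(mulrCA lambda); lra.
Qed.

End energy_facts.

(** * Convergence of the discrete minimisers *)

Theorem theorem7 (R : realType) (d : nat) (hd : (0 < d)%N)
    (Om : set 'rV[R]_d) (Om_open : open Om) (Om_bounded : bounded_set Om)
    (Om_convex : convex_set (Om : set (convex_lmodType 'rV[R]_d)))
    (a : 'I_d -> 'I_d -> 'rV[R]_d -> R) (c : 'rV[R]_d -> R)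
    (L_elliptic : elliptic_coefficients Om a c)
    (f : 'rV[R]_d -> R) (f_L2 : L2 Om f)
    (lambda : R) (lambda_gt0 : 0 < lambda)
    (m : nat) (hm : (2 < m)%N)
    (V : nat -> set ('rV[R]_d -> R)) (V_approx : approximating_spaces Om m V)
    (J : ('rV[R]_d -> R) -> R)
    (J_convex : @convex_function R ('rV[R]_d -> R^o) (sobolev Om 2) J)
    (J_consistent : consistent (sobolev Om 2) (sobolev_norm Om 2) J)
    (u_ : nat -> 'rV[R]_d -> R) (u_V : forall l, V l (u_ l))
    (u_min : forall l v, (energy_reg_disc Om a c f lambda J V l (u_ l)
                          <= energy_reg_disc Om a c f lambda J V l v)%E)
    (u : 'rV[R]_d -> R) (u_H2 : sobolev Om 2 u) (u_H10 : sobolev10 Om u)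
    (u_lambda_min : forall v, sobolev Om 2 v -> sobolev10 Om v ->
       energy_reg Om a c f lambda J u <= energy_reg Om a c f lambda J v) :
  sobolev_norm Om 1 (u_ l \- u) @[l --> \oo] --> (0 : R).
Proof.
have mOm := open_rV_measurable Om_open.
have [Vsub [beta [betat [_ Vapp]]]] := V_approx.
have [beta0 [w_ [wV _]]] := Vapp u u_H2 u_H10.
have wu : sobolev_norm Om 2 (w_ l \- u) @[l --> \oo] --> (0 : R).
  apply: (@squeeze_cvgr _ _ _ _ (fun=> 0) (fun l => beta l u)) => //.
  - by apply: nearW => l; rewrite sqrtr_ge0; exact: (wV l).2.
  - exact: cvg_cst.
have wH l : sobolev Om 2 (w_ l) /\ sobolev10 Om (w_ l) := Vsub l _ (wV l).1.
have uH l : sobolev Om 2 (u_ l) /\ sobolev10 Om (u_ l) := Vsub l _ (u_V l).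
have disc l v : V l v ->
    energy_reg_disc Om a c f lambda J V l v = (energy_reg Om a c f lambda J v)%:E.
  move=> Vv; rewrite /energy_reg_disc; case: asboolP => // nV; case: nV.
  by have [sv v10] := Vsub l _ Vv.
have le_uw l : energy_reg Om a c f lambda J (u_ l) <= energy_reg Om a c f lambda J (w_ l).
  by have := u_min l (w_ l); rewrite !disc ?lee_fin//; exact: (wV l).1.
have cvg_w : energy_reg Om a c f lambda J (w_ l) @[l --> \oo] -->
    energy_reg Om a c f lambda J u.
  apply: cvgD.
    by apply: energy_cvg => // l; exact: (wH l).1.
  apply: cvgMr; have [_ _] := J_consistent; apply => // l.
  exact: (wH l).1.
have sB l : sobolev Om 2 (u_ l \- u) :=
  sobolevB Om_open Om_bounded (uH l).1 u_H2.
have B10 l : sobolev10 Om (u_ l \- u) :=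
  sobolev10B Om_open Om_bounded (uH l).2 u_H10.
pose L := elliptic_op Om a c.
have L0 : ip Om (L (u_ l \- u)) (L (u_ l \- u)) @[l --> \oo] --> (0 : R).
  apply: (@squeeze_cvgr _ _ _ _ (fun=> 0) (fun l =>
    2 * (energy_reg Om a c f lambda J (w_ l) - energy_reg Om a c f lambda J u))).
  - apply: nearW => l; rewrite ip_ge0 /=.
    have [ul1 ul2] := uH l.
    have := minimiser_gap Om_open Om_bounded L_elliptic f_L2 lambda_gt0 J_convex
      u_H2 u_H10 u_lambda_min ul1 ul2.
    by move/le_trans; apply; rewrite ler_pM2l// lerB.
  - exact: cvg_cst.
  - rewrite [X in _ --> X](_ : 0 = 2 * 0); last by rewrite mulr0.
    by apply: cvgMr; apply/subr_cvg0.
have LL l : L2 Om (L (u_ l \- u)).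
  have [_ [_ [sc _]]] := L_elliptic.
  by apply: (elliptic_L2 Om_open Om_bounded a sc); exact: sobolev_L2 (sB l).
have [C HC] := coercive Om_open Om_bounded L_elliptic hd.
have Lnull : L2_null (Om := Om) (fun l => L (u_ l \- u)) by [].
apply: null_sobolev_norm => al al1.
apply: (L2_null_le (K := C) Lnull); first by move=> l; exact: wderiv_L2.
move=> l; have [Hi H0] := HC _ (sB l) (B10 l).
have [al0|[i ->]] := mlength_le1 al1; last exact: Hi.
have Lul := sobolev_L2 (sB l); have E := wderiv0 Om_open Om_bounded Lul al0.
have mE := L2_measurable (wderiv_L2 Om_open al (u_ l \- u)).
by rewrite (ip_ae mOm mE (L2_measurable Lul) mE (L2_measurable Lul) E E).
Qed.
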